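(* Let $d\ge2$, and let $\mathcal X=\{\mathcal X_n\}$ be a prior supported on unit vectors in $\mathbb R^n$. Suppose the following holds for some $\lambda^*>0$: (i) the distribution of $\langle x,x'\rangle$, where $x,x'$ are drawn independently from $\mathcal X$, is symmetric about zero; (ii) $\mathcal X$ has a rate function $f_{\mathcal X}$; (iii) $f_{\mathcal X}(t)\ge\frac{(\lambda^* )^2}{2}\frac{t^d}{1+t^d}$ for all $t\in[0,1)$; (iv) $\mathcal X$ is locally subgaussian with some constant $\sigma^2$; (v) if $d=2$, then $\lambda^*\le1/\sigma$. Then for all $\lambda<\lambda^*$: (1) $\mathrm{WT}(d,\lambda,\mathcal X)$ is contiguous to $\mathrm{WT}(d)$, so strong detection is impossible; (2) if $d\ge3$, the total variation distance between $\mathrm{WT}_n(d,\lambda,\mathcal X)$ and $\mathrm{WT}_n(d)$ is $o(1)$ as $n\to\infty$, so weak detection is impossible; (3) if $d\ge3$, no estimator $\hat x=\hat x(T)$ (a unit vector), given a sample $T=\lambda x^{\otimes d}+W\sim\mathrm{WT}(d,\lambda,\mathcal X)$, achieves expected correlation $\mathbb E|\langle x,\hat x\rangle|$ with the true spike $x$ bounded above $0$ (i.e. bounded away from $0$) as $n\to\infty$; that is, weak recovery is impossible.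
   Context: Wigner tensor: for integers $d\ge2$, $n\ge1$, $\mathrm{WT}(d)=\mathrm{WT}_n(d)$ is the law of the symmetric tensor $W\in(\mathbb R^n)^{\otimes d}$ obtained by drawing $W'\in\mathbb R^{n^d}$ with i.i.d. $\mathcal N(0,2/n)$ entries and averaging it over all $d!$ permutations of the indices. Spiked model: a prior $\mathcal X=\{\mathcal X_n\}$ is a family of distributions (one for each $n$) on unit vectors of $\mathbb R^n$. For $\lambda\ge0$ (not depending on $n$), $\mathrm{WT}(d,\lambda,\mathcal X)=\mathrm{WT}_n(d,\lambda,\mathcal X)$ is the law of $T=\lambda x^{\otimes d}+W$ with $x\sim\mathcal X_n$ and $W\sim\mathrm{WT}_n(d)$ independent. Rate function: for $x,x'$ drawn independently from $\mathcal X_n$ and $t\in[0,1)$ let $f_{n,\mathcal X}(t)=-\frac1n\log\Pr[\langle x,x'\rangle\ge t]$. If $f_{n,\mathcal X}(t)\ge b_{n,\mathcal X}(t)$ for some sequence of functions $b_{n,\mathcal X}$ converging uniformly on $[0,1)$ to $f_{\mathcal X}$ as $n\to\infty$, then $f_{\mathcal X}$ is called a rate function of $\mathcal X$. Locally subgaussian with constant $\sigma^2$: for all $\eta>0$ there exist $t_0>0$ and $C>0$ (which may depend on $\eta$ but not on $n$) such that $\Pr_{x,x'\sim\mathcal X_n}[\langle x,x'\rangle\ge t]\le C\exp\left(-\frac{nt^2}{2\sigma^2+\eta}\right)$ for all $t\in[0,t_0]$. Contiguity: $P_n$ is contiguous to $Q_n$ if for any sequence of events $A_n$ with $Q_n(A_n)\to0$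 one also has $P_n(A_n)\to0$. Detection: one is given a single sample from either $\mathrm{WT}(d,\lambda,\mathcal X)$ or $\mathrm{WT}(d)$, each with probability $1/2$. Strong detection means deciding which one with success probability $1-o(1)$ as $n\to\infty$; weak detection means deciding with success probability at least $\frac12+\varepsilon$ as $n\to\infty$ for some $\varepsilon>0$ not depending on $n$. *)

(* Defs.v *)
From HB Require Import structures.
From mathcomp Require Import all_boot all_order all_algebra perm.
From mathcomp Require Import all_classical all_reals all_analysis.
From mathcomp Require Import measurable_realfun.

Set Implicit Arguments.
Unset Strict Implicit.
Unset Printing Implicit Defensive.

Import Order.TTheory GRing.Theory Num.Theory.
Import numFieldNormedType.Exports.

Local Open Scope classical_set_scope.
Local Open Scope ring_scope.

(* Vectors and tensors are tuples, which carry the product Borel              *)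
(* sigma-algebra.  A tensor in (R^n)^{(x) d} is the tuple of its n^d entries, *)
(* numbered by [enum_rank] on the multi-indices [{ffun 'I_d -> 'I_n}].        *)
Notation rvec R n := (n.-tuple (measurableTypeR R)).
Notation tensor R d n :=
  (#|{: {ffun 'I_d -> 'I_n}}|.-tuple (measurableTypeR R)).

Section vectors_and_tensors.
Context {R : realType}.

Definition dotp n (x y : rvec R n) : R := \sum_(i < n) tnth x i * tnth y i.

(* <x, x> = 1, i.e. x has Euclidean norm 1 *)
Definition unit_vec n (x : rvec R n) : Prop := dotp x x = 1.

Definition tentry d n (W : tensor R d n) (i : {ffun 'I_d -> 'I_n}) : R :=
  tnth W (enum_rank i).

Definition mktensor d n (F : {ffun 'I_d -> 'I_n} -> R) : tensor R d n :=
  [tuple F (enum_val k) | k < #|{: {ffun 'I_d -> 'I_n}}|].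

Definition symmetrize d n (W : tensor R d n) : tensor R d n :=
  mktensor (fun i =>
    (d`!%:R)^-1 * \sum_(s : 'S_d) tentry W [ffun k => i (s k)]).

Definition tensor_pow d n (x : rvec R n) : tensor R d n :=
  mktensor (fun i => \prod_(k < d) tnth x (i k)).

Definition spike d n (lambda : R) (p : rvec R n * tensor R d n) : tensor R d n :=
  mktensor (fun i => lambda * tentry (tensor_pow d p.1) i + tentry p.2 i).

End vectors_and_tensors.

Section measurability.
Context {R : realType}.

Lemma measurable_tentry d n (i : {ffun 'I_d -> 'I_n}) :
  measurable_fun [set: tensor R d n] (fun W => tentry W i).
Proof. exact: measurable_tnth. Qed.

Lemma measurable_mktensor {dd} {T : measurableType dd} d n
    (F : T -> {ffun 'I_d -> 'I_n} -> R) :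
  (forall i, measurable_fun [set: T] (F ^~ i)) ->
  measurable_fun [set: T] (fun t => mktensor (F t) : tensor R d n).
Proof.
move=> mF; apply/measurable_fun_tnthP => k.
apply: (eq_measurable_fun (F ^~ (enum_val k))) => // t _ /=.
by rewrite tnth_mktuple.
Qed.

Lemma measurable_symmetrize d n :
  measurable_fun [set: tensor R d n] (@symmetrize R d n).
Proof.
apply: measurable_mktensor => i; apply: measurable_funM => //.
by apply: measurable_sum => s; exact: measurable_tentry.
Qed.

Lemma measurable_tensor_pow d n :
  measurable_fun [set: rvec R n] (@tensor_pow R d n).
Proof.
apply: measurable_mktensor => i.
by apply: measurable_prod => k _; exact: measurable_tnth.
Qed.

Lemma measurable_spike d n (lambda : R) :
  measurable_fun [set: rvec R n * tensor R d n] (@spike R d n lambda).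
Proof.
apply: measurable_mktensor => i; apply: measurable_funD.
  apply: measurable_funM => //.
  apply: (measurableT_comp (measurable_tentry i)).
  exact: (measurableT_comp (@measurable_tensor_pow d n)).
exact: (measurableT_comp (measurable_tentry i)).
Qed.

HB.instance Definition _ d n := isMeasurableFun.Build _ _ _ _
  (@symmetrize R d n) (@measurable_symmetrize d n).

HB.instance Definition _ d n lambda := isMeasurableFun.Build _ _ _ _
  (@spike R d n lambda) (@measurable_spike d n lambda).

End measurability.

Section iid.
Context {dd} {T : measurableType dd} {R : realType}.

Definition tcons n (p : T * n.-tuple T) : n.+1.-tuple T :=
  [tuple of p.1 :: p.2].

Lemma measurable_tcons n : measurable_fun [set: T * n.-tuple T] (@tcons n).
Proof. exact: measurable_cons. Qed.

HB.instance Definition _ n := isMeasurableFun.Build _ _ _ _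
  (@tcons n) (@measurable_tcons n).

(* the n-fold product of P: law of n independent draws from P *)
Fixpoint iid (P : probability T R) (n : nat) : probability (n.-tuple T) R :=
  match n with
  | 0 => \d_([tuple] : 0.-tuple T)
  | m.+1 => distribution (P \x iid P m)%E (@tcons m)
  end.

End iid.

Section wigner.
Context {R : realType}.

(* [normal_prob m s] takes the standard deviation s, so this is N(0, 2/n).    *)
Definition wigner_tensor d n : probability (tensor R d n) R :=
  distribution
    (iid (normal_prob (0 : R) (Num.sqrt (2 / n%:R)))
         #|{: {ffun 'I_d -> 'I_n}}|)
    (@symmetrize R d n).

(* In all that concerns a prior only the dimensions n >= 1 matter: there is   *)
(* no unit vector in R^0.                                                     *)
Definition prior := forall n, probability (rvec R n) R.

Definition unit_prior (X : prior) : Prop :=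
  forall n, (0 < n)%N -> X n [set x | unit_vec x] = 1%E.

Definition spiked_tensor d (lambda : R) (X : prior) n :
    probability (tensor R d n) R :=
  distribution (X n \x wigner_tensor d n)%E (@spike R d n lambda).

Definition overlap_prob (X : prior) n (A : set R) : \bar R :=
  (X n \x X n)%E [set p | A (dotp p.1 p.2)].

Definition symmetric_overlap (X : prior) : Prop :=
  forall n, (0 < n)%N -> forall A : set (measurableTypeR R), measurable A ->
    overlap_prob X n A = overlap_prob X n [set r | A (- r)].

(* f_{n,X}(t); it is +oo when the probability is 0, as [lne 0 = -oo].         *)
Definition overlap_rate (X : prior) n (t : R) : \bar R :=
  (- ((n%:R^-1)%:E * lne (overlap_prob X n [set r | (t <= r)%R])))%E.

Definition rate_function (X : prior) (f : R -> R) : Prop :=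
  exists b : nat -> R -> R,
    (forall n, (0 < n)%N -> forall t, 0 <= t < 1 ->
       ((b n t)%:E <= overlap_rate X n t)%E) /\
    {uniform `[0, 1[, b @ \oo --> f}.

(* [v] plays the role of sigma^2.                                             *)
Definition locally_subgaussian (X : prior) (v : R) : Prop :=
  forall eta, 0 < eta -> exists t0 C : R, [/\ 0 < t0, 0 < C &
    forall n, (0 < n)%N -> forall t, 0 <= t <= t0 ->
      (overlap_prob X n [set r | (t <= r)%R] <=
       (C * expR (- (n%:R * t ^+ 2 / (2 * v + eta))))%:E)%E].

(* An estimator is a measurable map into the unit sphere; the expectation is  *)
(* over the joint law of (x, W), with T = lambda x^{(x) d} + W.               *)
Definition expected_correlation d (lambda : R) (X : prior) n
    (xhat : tensor R d n -> rvec R n) : \bar R :=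
  (\int[X n \x wigner_tensor d n]_p
     `|dotp p.1 (xhat (spike lambda p))|%:E)%E.

Definition weak_recovery d (lambda : R) (X : prior) : Prop :=
  exists xhat : forall n, tensor R d n -> rvec R n,
    (forall n, (0 < n)%N -> measurable_fun setT (@xhat n) /\
       forall W, unit_vec (@xhat n W)) /\
    exists2 c : R, 0 < c &
      \forall n \near \oo, (c%:E <= expected_correlation lambda X (@xhat n))%E.

End wigner.
Arguments prior : clear implicits.
Arguments wigner_tensor R d n : clear implicits.

Section two_hypotheses.
Context {dd : measure_display} {U : measurableType dd} {R : realType}.
Implicit Types p q : probability U R.

Definition total_variation_dist p q : \bar R :=
  ereal_sup [set `|p A - q A|%E | A in [set A : set U | measurable A]].

(* probability of a correct answer when the sample comes from p or q with     *)
(* probability 1/2 each, for the test that answers "p" on A and "q" off A     *)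
Definition success_prob p q (A : set U) : \bar R :=
  ((2^-1)%:E * p A + (2^-1)%:E * q (~` A))%E.

End two_hypotheses.

Section hypothesis_testing.
Context {dd : measure_display} {T : nat -> measurableType dd} {R : realType}.
Implicit Types P Q : forall n, probability (T n) R.

Definition contiguous P Q : Prop :=
  forall A : forall n, set (T n), (forall n, measurable (A n)) ->
    (Q n (A n) @[n --> \oo] --> 0)%E -> (P n (A n) @[n --> \oo] --> 0)%E.

Definition strong_detection P Q : Prop :=
  exists A : forall n, set (T n), (forall n, measurable (A n)) /\
    (success_prob (P n) (Q n) (A n) @[n --> \oo] --> 1)%E.

Definition weak_detection P Q : Prop :=
  exists A : forall n, set (T n), (forall n, measurable (A n)) /\
    exists2 eps : R, 0 < eps &
      \forall n \near \oo,
        ((2^-1 + eps)%:E <= success_prob (P n) (Q n) (A n))%E.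

End hypothesis_testing.

(* Main.v *)
(* Truncated second moment.  The noise may be taken before symmetrization,     *)

(* Why truncation is needed: the plain second moment of the likelihood ratio is the mean of
   [exp (n l^2/2 <x,y>^d)], and its boundedness would ask the overlap rate to beat [l^2/2 t^d]. It
   is inflated by rare noises strongly aligned with the spike. Discarding them ([truncation_event])
   loses little mass ([truncation_error]) and lowers the exponent to [l^2/2 t^d/(1 + t^d)]
   ([truncated_pair_le]), which the hypothesis on the rate function beats strictly when
   [l < lambda_star].

   The rate function is known only up to a uniform additive error, so it settles the overlaps above
   a fixed [t0] ([large_moment_vanishes]). Below [t0] the subgaussian tail competes with
   [exp (n l^2/2 t^d)]. For d >= 3, [t^d <= t0 t^2], so any subgaussian constant wins once [t0] is
   small, and the excess of the moment over 1 vanishes ([cubic_moments_vanish]). For d = 2 both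
   exponents are quadratic and [l * sigma < 1] decides ([second_moment_bounded]).

   The passage from moments to statistics is done for an abstract bounded kernel in
   [truncated_contiguity], [truncated_total_variation] and [truncated_recovery]; [likelihood_shift]
   and [integral_spiked_le] connect it to the tensor model. *)
(* i.i.d. N(0, 2/n) on R^(n^d), because x^{(x) d} is symmetric; Cameron-Martin *)
(* then gives the likelihood ratio L(x, w), and truncating it to the event     *)
(* <x^{(x) d}, w> <= l + delta loses only exponentially small mass.  Bounding  *)
(* the two indicators by an exponential tilt (Chernoff), a Gaussian moment     *)
(* generating function shows that the truncated ratios of x and y have product *)
(* moment at most exp (n l^2/2 r) and, for an optimal tilt,                    *)
(* exp (n (l^2/2 r/(1 + r) + l delta)), where r = |<x, y>|^d.  The first bound *)
(* is integrated over small overlaps with the subgaussian tail, the second     *)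
(* over the remaining overlaps with the rate function.  Hence the truncated    *)
(* second moment is bounded, and for d >= 3 it tends to 1 while the same       *)
(* integral weighted by <x, y>^2 tends to 0.  Boundedness gives contiguity,    *)
(* convergence to 1 gives total variation; for an estimator xh,                *)
(* <x, xh>^2 = <x^{(x) 2}, xh^{(x) 2}>, so Cauchy-Schwarz bounds its posterior *)
(* mean by the norm of that of x^{(x) 2}, which the weighted integral controls.*)
(* Every Cauchy-Schwarz is used in its AM-GM form, with a free parameter.      *)
From HB Require Import structures.
Require Import Defs.
From mathcomp Require Import all_boot all_order all_algebra perm.
From mathcomp Require Import all_classical all_reals all_analysis.
From mathcomp Require Import ring lra measurable_realfun.

Import Order.TTheory GRing.Theory Num.Theory.
Import numFieldNormedType.Exports.

Local Open Scope classical_set_scope.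
Local Open Scope ring_scope.

(** * Gaussian measures under translation *)

Section density.
Context d (T : measurableType d) (R : realType).
Variables (mu nu : {measure set T -> \bar R}) (g : T -> R).
Hypotheses (mg : measurable_fun setT g) (g0 : forall x, 0 <= g x).
Hypothesis nuE : forall A, measurable A -> nu A = (\int[mu]_(x in A) (g x)%:E)%E.
Local Open Scope ereal_scope.
Import HBNNSimple.

Let integral_indic_density A : measurable A ->
  \int[nu]_x (\1_A x)%:E = \int[mu]_x ((\1_A x)%:E * (g x)%:E).
Proof.
move=> mA; rewrite integral_indic// setIT nuE// integral_mkcond.
apply: eq_integral => x _; rewrite patchE indicE.
by case: ifPn; rewrite ?mul1e ?mul0e.
Qed.

Let integral_nnsfun_density (f : {nnsfun T >-> R}) :
  \int[nu]_x (f x)%:E = \int[mu]_x ((f x)%:E * (g x)%:E).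
Proof.
under [LHS]eq_integral do rewrite fimfunE -fsumEFin//.
rewrite [LHS]ge0_integral_fsum//; last 2 first.
  - by move=> r; exact/measurable_EFinP/measurableT_comp.
  - by move=> n x _; rewrite EFinM nnfun_muleindic_ge0.
under [RHS]eq_integral => x _.
  rewrite fimfunE -fsumEFin// ge0_mule_fsuml; last first.
    by move=> r; rewrite nnfun_muleindic_ge0.
  over.
rewrite [RHS]ge0_integral_fsum//; last 2 first.
  - move=> r; apply: emeasurable_funM; last exact/measurable_EFinP.
    by apply/measurable_EFinP; exact: measurableT_comp.
  - by move=> r x _; apply: mule_ge0; rewrite ?lee_fin// -lee_fin EFinM nnfun_muleindic_ge0.
apply: eq_fsbigr => r _.
rewrite integralZl_indic_nnsfun// integral_indic_density//.
(* A negative r is not a value of f, so its level set is empty and both sides vanish. *)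
have [r0|r0] := ltP r 0%R.
  rewrite preimage_nnfun0// !integral0_eq ?mule0//.
    by move=> x _; rewrite indicE in_set0 mulr0 mul0e.
  by move=> x _; rewrite indicE in_set0 mul0e.
rewrite -ge0_integralZl_EFin//.
- by apply: eq_integral => x _; rewrite EFinM muleA.
- by move=> x _; rewrite mule_ge0 ?lee_fin.
- apply: emeasurable_funM; last exact/measurable_EFinP.
  exact/measurable_EFinP.
Qed.

(** The density hypothesis gives indicators, linearity gives simple functions, and monotone
    convergence along [nnsfun_approx] gives the rest. *)
Lemma ge0_integral_density (f : T -> \bar R) :
  measurable_fun setT f -> (forall x, 0 <= f x) ->
  \int[nu]_x f x = \int[mu]_x (f x * (g x)%:E).
Proof.
move=> mf f0; pose f_ := nnsfun_approx measurableT mf.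
transitivity (limn (fun n => \int[nu]_x (f_ n x)%:E)).
  rewrite -monotone_convergence//=.
  - apply: eq_integral => x _; apply/esym/cvg_lim => //=.
    exact: cvg_nnsfun_approx.
  - by move=> n; exact/measurable_EFinP.
  - by move=> n x _; rewrite lee_fin.
  - by move=> x _ a b ab; rewrite lee_fin; exact/lefP/nd_nnsfun_approx.
under eq_fun do rewrite integral_nnsfun_density.
rewrite -monotone_convergence//=.
- apply: eq_integral => x _; apply/cvg_lim => //=.
  by apply: cvgeZr => //; exact: cvg_nnsfun_approx.
- by move=> n; apply: emeasurable_funM; exact/measurable_EFinP.
- by move=> n x _; rewrite mule_ge0 ?lee_fin.
- move=> x _ a b ab; apply: lee_wpmul2r; rewrite lee_fin//.
  exact/lefP/nd_nnsfun_approx.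
Qed.

End density.

Section gaussian_translation.
Context {R : realType}.

(** By uniqueness of Lebesgue measure, half-open intervals are enough, and a translation preserves
    their length. *)
Lemma lebesgue_measure_translation (v : R) (A : set R) : measurable A ->
  pushforward lebesgue_measure ((fun x => x + v) : measurableTypeR R -> measurableTypeR R) A
  = lebesgue_measure A.
Proof.
have mv : measurable_fun setT ((fun x => x + v) : measurableTypeR R -> measurableTypeR R).
  exact: measurable_funD.
move=> mA; apply/esym.
pose isM := isMeasurableFun.Build _ _ _ _ _ mv.
pose phi : {mfun measurableTypeR R >-> measurableTypeR R} := HB.pack ((fun x => x + v) : measurableTypeR R -> measurableTypeR R) isM.
apply: (@lebesgue_measure_unique _ (pushforward lebesgue_measure phi)) => //= _ [[a b]] _ <-.
rewrite /pushforward/=.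
rewrite (_ : _ @^-1` _ = `]a - v, b - v]%classic); last first.
  by apply/seteqP; split => x/=; rewrite !in_itv/= ltrBlDr lerBrDr.
rewrite !lebesgue_measure_itv/= !lte_fin ltrD2r; case: ifP => // _.
by rewrite -!EFinB; congr EFin; ring.
Qed.

Lemma ge0_integral_translation (v : R) (f : R -> \bar R) :
  measurable_fun setT f -> (forall x, 0 <= f x)%E ->
  (\int[lebesgue_measure]_x f (x + v)%R = \int[lebesgue_measure]_x f x)%E.
Proof.
move=> mf f0.
have mv : measurable_fun setT ((fun x => x + v) : measurableTypeR R -> measurableTypeR R).
  exact: measurable_funD.
rewrite -[LHS](ge0_integral_pushforward mv lebesgue_measure measurableT mf)//.
by apply: eq_measure_integral => A mA _; exact: lebesgue_measure_translation.
Qed.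

(** After the substitution [w - v] in the Lebesgue integral, the exponential is the quotient of the
    Gaussian densities at [w - v] and at [w]. *)
Lemma normal_cameron_martin (s v : R) (h : R -> \bar R) : s != 0 ->
  measurable_fun setT h -> (forall x, 0 <= h x)%E ->
  (\int[normal_prob (0 : R) s]_w h (w + v)%R =
   \int[normal_prob (0 : R) s]_w
     (h w * (expR (v * w / s ^+ 2 - v ^+ 2 / (s ^+ 2 *+ 2))%R)%:E))%E.
Proof.
move=> s0 mh h0.
have mv (u : R) : measurable_fun setT ((fun x => x + u) : measurableTypeR R -> measurableTypeR R).
  exact: measurable_funD.
have E := ge0_integral_density _ _ _ lebesgue_measure (normal_prob (0:R) s)
  (normal_pdf 0 s) (measurable_normal_pdf 0 s) (normal_pdf_ge0 0 s) (fun _ _ => erefl).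
have me : measurable_fun setT (fun w : R => expR (v * w / s ^+ 2 - v ^+ 2 / (s ^+ 2 *+ 2))).
  apply: measurableT_comp => //; apply: measurable_funB => //.
  by apply: measurable_funM => //; exact: measurable_funM.
rewrite !E//=.
- pose k w := (h w * (normal_pdf 0 s (w - v)%R)%:E)%E.
  transitivity (\int[lebesgue_measure]_w k (w + v)%R)%E.
    by apply: eq_integral => x _; rewrite /k addrK.
  rewrite ge0_integral_translation.
  + apply: eq_integral => x _; rewrite /k -muleA; congr (_ * _)%E.
    rewrite -EFinM; congr EFin; rewrite normal_pdfE// mulrCA; congr *%R.
    rewrite /normal_fun -expRD; congr expR; rewrite !subr0.
    by field.
  + apply: emeasurable_funM => //; apply/measurable_EFinP.
    by apply: (measurableT_comp (measurable_normal_pdf 0 s)); exact: mv.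
  + by move=> x; rewrite mule_ge0// lee_fin normal_pdf_ge0.
- by apply: emeasurable_funM => //; apply/measurable_EFinP.
- by move=> x; rewrite mule_ge0// lee_fin expR_ge0.
- by apply: (measurableT_comp mh); exact: mv.
Qed.

End gaussian_translation.

Section iid_integral.
Context {dd : measure_display} {T : measurableType dd} {R : realType}.

Lemma ge0_integral_iidS (P : probability T R) n (f : n.+1.-tuple T -> \bar R) :
  measurable_fun setT f -> (forall x, 0 <= f x)%E ->
  (\int[iid P n.+1]_w f w =
   \int[P]_x \int[iid P n]_y f (tcons (x, y)))%E.
Proof.
move=> mf f0 /=; rewrite ge0_integral_pushforward//=.
by rewrite fubini_tonelli1//=; exact: measurableT_comp.
Qed.

End iid_integral.

Section iid_cameron_martin.
Context {R : realType}.

Definition vadd n (w v : rvec R n) : rvec R n :=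
  [tuple tnth w i + tnth v i | i < n].

Lemma measurable_vadd n (v : rvec R n) :
  measurable_fun setT (fun w : rvec R n => vadd n w v).
Proof.
apply/measurable_fun_tnthP => k.
apply: (eq_measurable_fun (fun w : rvec R n => tnth w k + tnth v k)) => [w _/=|].
  by rewrite tnth_mktuple.
by apply: measurable_funD => //; exact: measurable_tnth.
Qed.

Lemma measurable_dotp {d' : measure_display} {S : measurableType d'} n
    (f g : S -> rvec R n) :
  measurable_fun setT f -> measurable_fun setT g ->
  measurable_fun setT (fun w => dotp (f w) (g w)).
Proof.
move=> mf mg; apply: measurable_sum => i.
by apply: measurable_funM; apply: (measurableT_comp (measurable_tnth i)).
Qed.

Lemma dotp_tcons n (x y : R) (v w : rvec R n) :
  dotp (tcons (x, v)) (tcons (y, w)) = x * y + dotp v w.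
Proof.
rewrite /dotp big_ord_recl/=; congr (_ + _).
by apply: eq_bigr => i _; rewrite !tnthS.
Qed.

Lemma vadd_tcons n (x y : R) (v w : rvec R n) :
  vadd _ (tcons (x, v)) (tcons (y, w)) = tcons (x + y, vadd n v w).
Proof.
apply: eq_from_tnth => i; rewrite tnth_mktuple.
case: (unliftP ord0 i) => [j|] -> //=.
by rewrite !tnthS tnth_mktuple.
Qed.

(** Induction by Tonelli: with the head fixed, the induction hypothesis shifts the tail; then the
    one-dimensional case shifts the head. *)
Lemma iid_cameron_martin (s : R) n (v : rvec R n) (h : rvec R n -> \bar R) :
  s != 0 -> measurable_fun setT h -> (forall x, 0 <= h x)%E ->
  (\int[iid (normal_prob (0 : R) s) n]_w h (vadd n w v) =
   \int[iid (normal_prob (0 : R) s) n]_w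
     (h w * (expR (dotp v w / s ^+ 2 - dotp v v / (s ^+ 2 *+ 2))%R)%:E))%E.
Proof.
move=> s0; elim: n v h => [|n IH] v h mh h0.
  apply: eq_integral => w _; rewrite (tuple0 (vadd 0 w v)) (tuple0 w).
  by rewrite /dotp !big_ord0 !mul0r subrr expR0 mule1.
have me m (u : rvec R m) : measurable_fun setT
    (fun w : rvec R m => expR (dotp u w / s ^+ 2 - dotp u u / (s ^+ 2 *+ 2))).
  apply: measurableT_comp => //; apply: measurable_funB => //.
  by apply: measurable_funM => //; exact: measurable_dotp.
case/tupleP: v => v0 v.
(* [H] already carries the weight of the tail, so that the head can be shifted in the inner integral
   of [H]. *)
pose H p := (h (tcons p) *
  (expR (dotp v p.2 / s ^+ 2 - dotp v v / (s ^+ 2 *+ 2))%R)%:E)%E.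
have mH : measurable_fun setT H.
  apply: emeasurable_funM; first exact: measurableT_comp.
  by apply/measurable_EFinP; exact: (measurableT_comp (me _ v)).
have H0 p : (0 <= H p)%E by rewrite mule_ge0// lee_fin expR_ge0.
rewrite !ge0_integral_iidS; first last.
- by move=> x; exact: h0.
- by apply: (measurableT_comp mh); exact: measurable_vadd.
- by move=> x; rewrite mule_ge0// lee_fin expR_ge0.
- by apply: emeasurable_funM => //; apply/measurable_EFinP; exact: me.
transitivity (\int[normal_prob (0 : R) s]_x
    \int[iid (normal_prob (0 : R) s) n]_y H (x + v0, y)%R)%E.
  apply: eq_integral => x _.
  under eq_integral do rewrite -[cons_tuple v0 v]/(tcons (v0, v)) vadd_tcons.
  rewrite (IH v (fun y => h (tcons (x + v0, y))))//.
  by apply: (measurableT_comp mh); apply: (measurableT_comp (@measurable_tcons _ _ _)).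
have mFH := measurable_fun_fubini_tonelli_F (m2 := iid (normal_prob (0 : R) s) n) _ mH H0.
rewrite (normal_cameron_martin s v0 _ s0 mFH); last first.
  by move=> x; apply: integral_ge0 => y _.
apply: eq_integral => x _; rewrite /fubini_F -ge0_integralZr//.
- apply: eq_integral => y _.
  rewrite /H -muleA -EFinM -expRD; congr (_ * (expR _)%:E)%E.
  rewrite -[cons_tuple v0 v]/(tcons (v0, v)) !dotp_tcons/=.
  by field.
- exact: measurableT_comp.
Qed.

End iid_cameron_martin.

(** * Abstract truncated second moment *)

Section bounded_integrals.
Context {dd : measure_display} {T : measurableType dd} {R : realType}.
Variable P : probability T R.
Implicit Types f g : T -> R.

Lemma ge0_le_integral_EFin f g : measurable_fun setT f -> measurable_fun setT g ->
  (forall x, 0 <= f x) -> (forall x, f x <= g x) ->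
  (\int[P]_x (f x)%:E <= \int[P]_x (g x)%:E)%E.
Proof.
move=> mf mg f0 fg; apply: ge0_le_integral => //.
- by move=> x _; rewrite lee_fin.
- exact/measurable_EFinP.
- exact/measurable_EFinP.
- by move=> x _; rewrite lee_fin.
Qed.

Lemma ge0_integralD_EFin f g : measurable_fun setT f -> measurable_fun setT g ->
  (forall x, 0 <= f x) -> (forall x, 0 <= g x) ->
  (\int[P]_x (f x + g x)%:E = \int[P]_x (f x)%:E + \int[P]_x (g x)%:E)%E.
Proof.
move=> mf mg f0 g0; under eq_integral do rewrite EFinD.
by rewrite ge0_integralD//; [move=> x _; rewrite lee_fin|exact/measurable_EFinP|
  move=> x _; rewrite lee_fin|exact/measurable_EFinP].
Qed.

Lemma ge0_integralZl_real f (c : R) : measurable_fun setT f ->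
  (forall x, 0 <= f x) -> 0 <= c ->
  (\int[P]_x (c * f x)%:E = c%:E * \int[P]_x (f x)%:E)%E.
Proof.
move=> mf f0 c0; under eq_integral do rewrite EFinM.
by rewrite ge0_integralZl// ?lee_fin//; [exact/measurable_EFinP|
  move=> x _; rewrite lee_fin].
Qed.

Lemma integral_cst_prob (c : R) : (\int[P]_x c%:E = c%:E)%E.
Proof. by rewrite integral_cst//= probability_setT mule1. Qed.

Lemma bounded_integrable (B : R) f : measurable_fun setT f ->
  (forall x, `|f x| <= B) -> P.-integrable setT (EFin \o f).
Proof.
move=> mf fB; apply: measurable_bounded_integrable => //.
  exact: (le_lt_trans (probability_le1 P measurableT) (ltry _)).
exists B; split; first by rewrite num_real.
by move=> M BM x _; exact: (le_trans (fB x) (ltW BM)).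
Qed.

(** Two replicas: the square of a mean is the mean of a product over independent copies. This is how
    pairs of spikes enter. *)
Lemma sqr_integral_bounded (B : R) f : measurable_fun setT f ->
  (forall x, `|f x| <= B) ->
  ((fine (\int[P]_x (f x)%:E) ^+ 2)%:E =
   \int[P \x P]_p (f p.1 * f p.2)%:E)%E.
Proof.
move=> mf fB.
have intf := bounded_integrable B f mf fB.
have finf : (\int[P]_x (f x)%:E \is a fin_num)%E by exact: integrable_fin_num intf.
have B0 : 0 <= B by rewrite (le_trans _ (fB point)).
rewrite -integral12_prod_meas1; last first.
  apply: (@measurable_bounded_integrable _ _ _ (P \x P)%E (fun p => f p.1 * f p.2)) => //.
  - exact: (le_lt_trans (probability_le1 (P \x P)%E measurableT) (ltry _)).
  - by apply: measurable_funM; exact: measurableT_comp.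
  - exists (B * B); split; first by rewrite num_real.
    move=> M BM p _; apply: (le_trans _ (ltW BM)); rewrite normrM.
    by rewrite ler_pM.
rewrite expr2 EFinM {2}fineK// -integralZl//.
by apply: eq_integral => x _; rewrite /= fineK// muleC -integralZl.
Qed.

End bounded_integrals.

(* [K] is a truncated likelihood ratio: integrating against [K(x, w) dX dG] *)
(* replaces the joint law of spike and observation up to a total mass [e]. *)
Section truncated_second_moment.
Context {d1 d2 : measure_display} {S : measurableType d1} {T : measurableType d2}.
Context {R : realType}.
Variables (X : probability S R) (G : probability T R) (K : S * T -> R) (B : R).
Hypotheses (mK : measurable_fun setT K) (K0 : forall p, 0 <= K p).
Hypothesis KB : forall p, K p <= B.
Local Open Scope ereal_scope.

Let mKy w : measurable_fun setT (fun x => K (x, w)).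
Proof. by apply: (measurableT_comp mK). Qed.

Let mKpair (I : finType) (phi : I -> S -> R) :
  (forall i, measurable_fun setT (phi i)) ->
  measurable_fun setT (fun z : (S * S) * T =>
   (K (z.1.1, z.2) * K (z.1.2, z.2) * \sum_i phi i z.1.1 * phi i z.1.2)%R).
Proof.
move=> mphi; apply: measurable_funM.
  by apply: measurable_funM; apply: (measurableT_comp mK);
    apply: measurable_fun_pair => //; apply: measurableT_comp => //.
apply: measurable_sum => i.
by apply: measurable_funM; apply: (measurableT_comp (mphi i)); apply: measurableT_comp.
Qed.

(** Likelihood ratio of the observation: the kernel averaged over the prior. Boundedness of [K]
    makes [fine] lossless. *)
Definition marginal w : R := fine (\int[X]_x (K (x, w))%:E).

Lemma marginalE w : (marginal w)%:E = \int[X]_x (K (x, w))%:E.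
Proof.
apply: fineK; apply: (integrable_fin_num measurableT).
apply: (bounded_integrable X B (fun x => K (x, w))) => // x.
by rewrite ger0_norm.
Qed.

Lemma marginal_ge0 w : (0 <= marginal w)%R.
Proof. by apply: fine_ge0; apply: integral_ge0 => x _; rewrite lee_fin. Qed.

Lemma measurable_marginal : measurable_fun setT marginal.
Proof.
apply: measurableT_comp => //.
apply: (measurable_fun_fubini_tonelli_G (m1 := X) (fun p => (K p)%:E)) => //.
exact/measurable_EFinP.
Qed.

Lemma integral_marginalM (h : T -> R) : measurable_fun setT h -> (forall w, 0 <= h w)%R ->
  \int[X]_x \int[G]_w (K (x, w) * h w)%:E = \int[G]_w (marginal w * h w)%:E.
Proof.
move=> mh h0.
rewrite (fubini_tonelli (m1 := X) (m2 := G) (fun p => (K p * h p.2)%:E)); last 2 first.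
- apply/measurable_EFinP; apply: measurable_funM => //.
  exact: (measurableT_comp mh).
- by move=> p; rewrite lee_fin mulr_ge0.
apply: eq_integral => w _; rewrite EFinM marginalE -ge0_integralZr//.
- exact/measurable_EFinP.
- by move=> x _; rewrite lee_fin.
- by rewrite lee_fin.
Qed.

(** The two-replica moment weighted by the kernel of a feature map [phi]. The constant feature gives
    the second moment of [marginal]; the features of [x^{(x) 2}] serve for recovery. *)
Definition pair_moment (I : finType) (phi : I -> S -> R) : \bar R :=
  \int[X \x X]_p \int[G]_w
    (K (p.1, w) * K (p.2, w) * \sum_i phi i p.1 * phi i p.2)%:E.

(** The left side integrates the squared norm of the unnormalized posterior mean of [phi]; replicas
    in each coordinate and Tonelli, allowed by the nonnegative kernel, give the right side. *)
Lemma integral_sum_sqr (I : finType) (phi : I -> S -> R) (b : R) :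
  (forall i, measurable_fun setT (phi i)) ->
  (forall p i, `|K p * phi i p.1| <= b)%R ->
  (forall x y, 0 <= \sum_i phi i x * phi i y)%R ->
  \int[G]_w (\sum_i (fine (\int[X]_x (K (x, w) * phi i x)%:E)) ^+ 2)%:E =
  pair_moment I phi.
Proof.
move=> mphi phib phi0.
have KK0 (z : (S * S) * T) :
    0 <= (K (z.1.1, z.2) * K (z.1.2, z.2) * \sum_i phi i z.1.1 * phi i z.1.2)%:E.
  by rewrite lee_fin !mulr_ge0.
rewrite /pair_moment.
rewrite (fubini_tonelli (m1 := (X \x X : probability (S * S)%type R)) (m2 := G) (fun z : (S * S) * T =>
   (K (z.1.1, z.2) * K (z.1.2, z.2) * \sum_i phi i z.1.1 * phi i z.1.2)%:E)) //; last first.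
  by apply/measurable_EFinP; exact: mKpair.
apply: eq_integral => w _.
rewrite -sumEFin.
have mk i : measurable_fun setT (fun x => K (x, w) * phi i x)%R.
  exact: measurable_funM.
under eq_bigr => i _ do
  rewrite (sqr_integral_bounded X b _ (mk i) (fun x => phib (x, w) i)).
pose F i (p : S * S) : \bar R := (K (p.1, w) * phi i p.1 * (K (p.2, w) * phi i p.2))%:E.
have intF i : (X \x X).-integrable setT (F i).
  apply: (bounded_integrable (X \x X : probability (S * S)%type R) (b * b)).
    by apply: measurable_funM; apply: (measurableT_comp (mk i)).
  by move=> p; rewrite normrM ler_pM// (phib (_, _)).
rewrite -(integral_sum measurableT intF).
apply: eq_integral => p _; rewrite /F sumEFin; congr EFin.
by rewrite mulr_sumr; apply: eq_bigr => i _; ring.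
Qed.

Let unit1 : unit -> S -> R := fun=> cst 1%R.

Definition second_moment := pair_moment _ unit1.

Lemma integral_marginal_sqr : \int[G]_w (marginal w ^+ 2)%:E = second_moment.
Proof.
rewrite /second_moment -(integral_sum_sqr _ unit1 B)//.
- apply: eq_integral => w _; rewrite (big_pred1 tt); last by case.
  by rewrite /marginal; under [in RHS]eq_integral do rewrite mulr1.
- by move=> p i; rewrite mulr1 ger0_norm.
- by move=> x y; rewrite sumr_ge0// => i _; rewrite mulr1.
Qed.

(** Integrate the AM-GM bound [l <= theta / 2 * l ^+ 2 + (2 * theta)^-1] over A, with l the
    marginal. *)
Lemma truncated_contiguity (A : set T) (theta : R) : measurable A -> (0 < theta)%R ->
  \int[X]_x \int[G]_w (K (x, w) * \1_A w)%:E <=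
  (theta / 2)%:E * second_moment + ((2 * theta)^-1)%:E * G A.
Proof.
move=> mA th; rewrite integral_marginalM//.
have -> : G A = \int[G]_w (\1_A w)%:E by rewrite integral_indic// setIT.
rewrite -integral_marginal_sqr.
have mm := measurable_marginal.
have mm2 : measurable_fun setT (fun w => marginal w ^+ 2)%R by exact: measurable_funX.
have th1 : (0 <= theta / 2)%R by rewrite divr_ge0// ltW.
have th2 : (0 <= (2 * theta)^-1)%R by rewrite invr_ge0 mulr_ge0// ltW.
have mm20 w : (0 <= marginal w ^+ 2)%R by rewrite sqr_ge0.
rewrite -!ge0_integralZl_real// -ge0_integralD_EFin//; first last.
- by move=> x; rewrite mulr_ge0.
- by move=> x; rewrite mulr_ge0.
- exact: measurable_funM.
- exact: measurable_funM.
apply: ge0_le_integral_EFin.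
- exact: measurable_funM.
- by apply: measurable_funD; apply: measurable_funM.
- by move=> w; rewrite mulr_ge0// marginal_ge0.
move=> w; have l0 := marginal_ge0 w; set l := marginal w in l0 *.
rewrite indicE; case: (w \in A); rewrite ?(mulr0, mulr1, addr0).
  rewrite -subr_ge0.
  have -> : (theta / 2 * l ^+ 2 + (2 * theta)^-1 - l = (theta * l - 1) ^+ 2 / (2 * theta))%R.
    by field; rewrite gt_eqF.
  by rewrite divr_ge0 ?sqr_ge0// mulr_ge0// ltW.
by rewrite mulr_ge0 ?sqr_ge0// divr_ge0// ltW.
Qed.

(** On A, [l - 1 <= theta / 2 + (l - 1) ^+ 2 / (2 * theta)], and the mean of [(l - 1) ^+ 2] is at
    most [m - 2 * (1 - e) + 1 = m - 1 + 2 * e]. *)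
Lemma truncated_total_variation (A : set T) (theta m e : R) : measurable A ->
  (0 < theta)%R -> second_moment <= m%:E ->
  (1 - e)%:E <= \int[X]_x \int[G]_w (K (x, w))%:E ->
  \int[X]_x \int[G]_w (K (x, w) * \1_A w)%:E <=
  G A + (theta / 2 + (m - 1 + 2 * e) / (2 * theta))%:E.
Proof.
move=> mA th hm he; have mm := measurable_marginal.
have he' : (1 - e)%:E <= \int[G]_w (marginal w)%:E.
  apply: (le_trans he); have := integral_marginalM (cst 1%R) (measurable_cst _) (fun=> ler01).
  under eq_integral do under eq_integral do rewrite mulr1.
  by move=> ->; under eq_integral do rewrite mulr1.
rewrite integral_marginalM//.
have th2 : (0 <= (2 * theta)^-1)%R by rewrite invr_ge0 mulr_ge0// ltW.
(* The cross term of the expanded square is moved to the left, which keeps both integrands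
   nonnegative. *)
have : \int[G]_w (marginal w * \1_A w + theta^-1 * marginal w)%:E <=
       \int[G]_w (\1_A w + (theta / 2 + (2 * theta)^-1 + (2 * theta)^-1 * marginal w ^+ 2))%:E.
  apply: ge0_le_integral_EFin.
  - by apply: measurable_funD; apply: measurable_funM.
  - apply: measurable_funD => //; apply: measurable_funD => //.
    by apply: measurable_funM => //; exact: measurable_funX.
  - by move=> w; rewrite addr_ge0// mulr_ge0 ?marginal_ge0// invr_ge0 ltW.
  move=> w; have l0 := marginal_ge0 w; set l := marginal w in l0 *.
  rewrite indicE; case: (w \in A); rewrite ?(mulr0, mulr1, add0r, mulr0n, mulr1n); rewrite -subr_ge0.
    have -> : (1 + (theta / 2 + (2 * theta)^-1 + (2 * theta)^-1 * l ^+ 2) - (l + theta^-1 * l)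
             = (theta - (l - 1)) ^+ 2 / (2 * theta))%R.
      by field; rewrite gt_eqF.
    by rewrite divr_ge0 ?sqr_ge0// mulr_ge0// ltW.
  have -> : (theta / 2 + (2 * theta)^-1 + (2 * theta)^-1 * l ^+ 2 - theta^-1 * l
             = theta / 2 + (l - 1) ^+ 2 / (2 * theta))%R.
    by field; rewrite gt_eqF.
  by rewrite addr_ge0 ?divr_ge0 ?sqr_ge0 ?mulr_ge0// ltW.
rewrite ge0_integralD_EFin//; first last.
- by move=> w; rewrite mulr_ge0 ?marginal_ge0// invr_ge0 ltW.
- by move=> w; rewrite mulr_ge0 ?marginal_ge0.
- exact: measurable_funM.
- exact: measurable_funM.
have mm2 : measurable_fun setT (fun w => marginal w ^+ 2)%R by exact: measurable_funX.
have mm20 w : (0 <= marginal w ^+ 2)%R by rewrite sqr_ge0.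
have th1 : (0 <= theta / 2)%R by rewrite divr_ge0// ltW.
have thi0 : (0 <= theta^-1)%R by rewrite invr_ge0 ltW.
have ml0 := marginal_ge0.
rewrite ge0_integralD_EFin//; first last.
- by move=> w; rewrite !addr_ge0// mulr_ge0.
- by apply: measurable_funD => //; exact: measurable_funM.
rewrite ge0_integralD_EFin//; first last.
- by move=> w; rewrite mulr_ge0.
- by move=> w; rewrite addr_ge0.
- exact: measurable_funM.
rewrite integral_cst_prob integral_indic// setIT.
rewrite !ge0_integralZl_real//.
rewrite integral_marginal_sqr => H.
set J := \int[G]_w (marginal w * \1_A w)%:E in H *.
have thi : (0 < theta^-1)%R by rewrite invr_gt0.
have H2 : J + (theta^-1 * (1 - e))%:E <=
    G A + (theta / 2 + (2 * theta)^-1 + (2 * theta)^-1 * m)%:E.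
  apply: (le_trans (le_trans _ H)).
    by apply: leeD => //; rewrite EFinM lee_pmul2l.
  apply: leeD => //; rewrite [leRHS]EFinD; apply: leeD => //.
  by rewrite EFinM; apply: lee_wpmul2l.
rewrite -leeBrDr// in H2; apply: (le_trans H2).
rewrite -addeA -EFinB; apply: leeD => //; rewrite lee_fin le_eqVlt; apply/orP; left.
by apply/eqP; field; rewrite gt_eqF.
Qed.

(** Averaging over the prior first leaves the scalar product of [psi] with the unnormalized
    posterior mean [m] of [phi]. AM-GM in each coordinate separates the unit vector [psi] from [m],
    whose squared norm integrates to [pair_moment]. *)
Lemma truncated_recovery (I : finType) (phi : I -> S -> R) (psi : I -> T -> R)
    (b theta : R) :
  (forall i, measurable_fun setT (phi i)) ->
  (forall i, measurable_fun setT (psi i)) ->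
  (forall p i, `|K p * phi i p.1| <= b)%R ->
  (forall x y, 0 <= \sum_i phi i x * phi i y)%R ->
  (forall x w, 0 <= \sum_i phi i x * psi i w)%R ->
  (forall w, \sum_i psi i w ^+ 2 = 1)%R -> (0 < theta)%R ->
  \int[X]_x \int[G]_w (K (x, w) * \sum_i phi i x * psi i w)%:E <=
  (theta / 2)%:E + ((2 * theta)^-1)%:E * pair_moment I phi.
Proof.
move=> mphi mpsi phib phi0 psi0 psi1 th.
have th2 : (0 <= (2 * theta)^-1)%R by rewrite invr_ge0 mulr_ge0// ltW.
rewrite -(integral_sum_sqr I phi b)//.
have mk i w : measurable_fun setT (fun x => K (x, w) * phi i x)%R.
  exact: measurable_funM.
have mkj i : measurable_fun setT (fun p : S * T => K p * phi i p.1)%R.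
  by apply: measurable_funM => //; apply: (measurableT_comp (mphi i)).
have ik i w : X.-integrable setT (EFin \o (fun x => K (x, w) * phi i x)%R).
  by apply: (bounded_integrable X b) => // x; exact: (phib (x, w)).
pose m i w := fine (\int[X]_x (K (x, w) * phi i x)%:E).
have mm i : measurable_fun setT (m i).
  apply: measurableT_comp => //.
  apply: (measurable_fubini_G (m1 := X) (m2 := G) (f := fun p => (K p * phi i p.1)%:E)).
  exact: (bounded_integrable (X \x G : probability (S * T)%type R) b).
rewrite (fubini_tonelli (m1 := X) (m2 := G)
   (fun p => (K p * \sum_i phi i p.1 * psi i p.2)%:E)); last 2 first.
- apply/measurable_EFinP; apply: measurable_funM => //.
  apply: measurable_sum => i; apply: measurable_funM.
    exact: (measurableT_comp (mphi i)).
  exact: (measurableT_comp (mpsi i)).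
- by move=> p; rewrite lee_fin mulr_ge0.
have E w : \int[X]_x (K (x, w) * \sum_i phi i x * psi i w)%:E =
    (\sum_i psi i w * m i w)%:E.
  pose F i x : \bar R := (psi i w)%:E * (K (x, w) * phi i x)%:E.
  transitivity (\int[X]_x (\sum_i F i x)).
    apply: eq_integral => x _; rewrite mulr_sumr -sumEFin.
    by apply: eq_bigr => i _; rewrite /F -EFinM; congr EFin; ring.
  have iF i : X.-integrable setT (F i) by exact: (integrableZl measurableT (psi i w) (ik i w)).
  rewrite (integral_sum measurableT iF).
  rewrite -sumEFin; apply: eq_bigr => i _.
  rewrite (integralZl measurableT (ik i w)) EFinM; congr (_ * _)%E.
  by rewrite fineK//; apply: (integrable_fin_num measurableT); exact: ik.
under eq_integral do rewrite E.
have msum : measurable_fun setT (fun w => \sum_i (m i w) ^+ 2)%R.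
  by apply: measurable_sum => i; exact: measurable_funX.
rewrite -ge0_integralZl_real//; last by move=> w; rewrite sumr_ge0// => i _; rewrite sqr_ge0.
rewrite -(integral_cst_prob G (theta / 2)).
rewrite -ge0_integralD_EFin//; first last.
- by move=> w; rewrite mulr_ge0// sumr_ge0// => i _; rewrite sqr_ge0.
- by move=> w; rewrite divr_ge0// ltW.
- exact: measurable_funM.
apply: ge0_le_integral_EFin.
- by apply: measurable_sum => i; exact: measurable_funM.
- by apply: measurable_funD => //; exact: measurable_funM.
- move=> w; rewrite -lee_fin -E; apply: integral_ge0 => x _.
  by rewrite lee_fin mulr_ge0.
move=> w; have -> : (theta / 2 = \sum_i theta / 2 * psi i w ^+ 2)%R.
  by rewrite -mulr_sumr psi1 mulr1.
rewrite mulr_sumr -big_split/=.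
apply: ler_sum => i _; rewrite -subr_ge0.
have -> : (theta / 2 * psi i w ^+ 2 + (2 * theta)^-1 * m i w ^+ 2 - psi i w * m i w
   = (theta * psi i w - m i w) ^+ 2 / (2 * theta))%R.
  by field; rewrite gt_eqF.
by rewrite divr_ge0 ?sqr_ge0// mulr_ge0// ltW.
Qed.

End truncated_second_moment.

(** * Spiked tensors and their likelihood ratio *)

Section tensor_algebra.
Context {R : realType}.

Lemma dotpDr n (u v w : rvec R n) : dotp u (vadd n v w) = dotp u v + dotp u w.
Proof. by rewrite -big_split; apply: eq_bigr => i _; rewrite tnth_mktuple mulrDr. Qed.

Lemma dotpC n (u v : rvec R n) : dotp u v = dotp v u.
Proof. by apply: eq_bigr => i _; rewrite mulrC. Qed.

Lemma dotpDl n (u v w : rvec R n) : dotp (vadd n v w) u = dotp v u + dotp w u.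
Proof. by rewrite dotpC dotpDr !(dotpC _ u). Qed.

Definition vscale n (c : R) (v : rvec R n) : rvec R n := [tuple c * tnth v i | i < n].

Lemma dotpZl n (c : R) (u v : rvec R n) : dotp (vscale n c u) v = c * dotp u v.
Proof. by rewrite mulr_sumr; apply: eq_bigr => i _; rewrite tnth_mktuple mulrA. Qed.

Lemma dotpZr n (c : R) (u v : rvec R n) : dotp u (vscale n c v) = c * dotp u v.
Proof. by rewrite dotpC dotpZl dotpC. Qed.

Lemma dotp_ge0 n (u : rvec R n) : 0 <= dotp u u.
Proof. by rewrite sumr_ge0// => i _; rewrite -expr2 sqr_ge0. Qed.

Lemma dotp_unit_le1 n (u v : rvec R n) : unit_vec u -> unit_vec v -> `|dotp u v| <= 1.
Proof.
rewrite /unit_vec => hu hv; rewrite ler_norml.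
have h1 := dotp_ge0 _ (vadd _ u v).
have h2 := dotp_ge0 n (vadd n u (vscale n (-1) v)).
move: h1 h2; rewrite !(dotpDl, dotpDr, dotpZl, dotpZr) hu hv (dotpC _ v u) => h1 h2.
by apply/andP; split; lra.
Qed.

Lemma tentry_mktensor d n (F : {ffun 'I_d -> 'I_n} -> R) i : tentry (mktensor F) i = F i.
Proof. by rewrite /tentry tnth_mktuple enum_rankK. Qed.

Lemma dotp_tensor d n (V W : tensor R d n) :
  dotp V W = \sum_i tentry V i * tentry W i.
Proof.
by rewrite /dotp (reindex (@enum_rank _))//; apply: onW_bij; exact: enum_rank_bij.
Qed.

Lemma eq_tensor d n (V W : tensor R d n) :
  (forall i, tentry V i = tentry W i) -> V = W.
Proof. by move=> VW; apply: eq_from_tnth => k; have := VW (enum_val k); rewrite /tentry enum_valK. Qed.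

Lemma dotp_tensor_pow d n (x y : rvec R n) :
  dotp (tensor_pow d x) (tensor_pow d y) = dotp x y ^+ d.
Proof.
rewrite dotp_tensor /dotp -[in RHS](card_ord d) -prodr_const bigA_distr_bigA/=.
by apply: eq_bigr => i _; rewrite !tentry_mktensor big_split.
Qed.

(** A tensor power is invariant under permutations of the indices, so symmetrization fixes it. Hence
    a spike may be added before symmetrizing, where the noise has independent entries. *)
Lemma symmetrize_vadd_tensor_pow d n (l : R) (x : rvec R n) (w : tensor R d n) :
  symmetrize (vadd _ w (vscale _ l (tensor_pow d x))) = spike l (x, symmetrize w).
Proof.
apply: eq_tensor => i; rewrite !tentry_mktensor/=.
have E (s : 'S_d) : tentry (vadd _ w (vscale _ l (tensor_pow d x))) [ffun k => i (s k)]
    = tentry w [ffun k => i (s k)] + l * \prod_(k < d) tnth x (i k).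
  rewrite /tentry tnth_mktuple; congr (_ + _).
  rewrite tnth_mktuple; congr (_ * _).
  rewrite -/(tentry (tensor_pow d x) _) tentry_mktensor.
  by rewrite [RHS](reindex_inj (@perm_inj _ s)); apply: eq_bigr => k _; rewrite ffunE.
rewrite (eq_bigr _ (fun (s : 'S_d) _ => E s)).
rewrite big_split mulrDr addrC; congr (_ + _).
by rewrite sumr_const card_Sn mulrnAr -mulrnAl -mulr_natl divff ?mul1r//.
Qed.

End tensor_algebra.

Section likelihood.
Context {R : realType}.
Variables (d n : nat) (n_gt0 : (0 < n)%N).
Local Notation s := (Num.sqrt (2 / n%:R) : R).
Local Notation G := (iid (normal_prob (0 : R) s) #|{: {ffun 'I_d -> 'I_n}}|).
Local Notation N := (n%:R : R).

Let N0 : 0 < N. Proof. by rewrite ltr0n. Qed.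
Let s2 : s ^+ 2 = 2 / N. Proof. by rewrite sqr_sqrtr// divr_ge0. Qed.
Let s0 : s != 0. Proof. by rewrite gt_eqF// sqrtr_gt0 divr_gt0. Qed.

(* likelihood ratio of [l x^{(x) d} + w] against [w], at i.i.d. N(0, 2/n) noise *)
Definition likelihood (l : R) (p : rvec R n * tensor R d n) : R :=
  expR (N / 2 * (l * dotp (tensor_pow d p.1) p.2 - l ^+ 2 / 2)).

Lemma measurable_dotp_tensor_pow :
  measurable_fun setT (fun p : rvec R n * tensor R d n => dotp (tensor_pow d p.1) p.2).
Proof.
by apply: measurable_dotp => //; exact: (measurableT_comp (@measurable_tensor_pow _ d n)).
Qed.

Lemma measurable_likelihood l : measurable_fun setT (likelihood l).
Proof.
apply: measurableT_comp => //; apply: measurable_funM => //; apply: measurable_funB => //.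
by apply: measurable_funM => //; exact: measurable_dotp_tensor_pow.
Qed.

(** Cameron-Martin with shift [l x^{(x) d}] and variance 2/n; the shift has norm l because x is a
    unit vector. The test function sees the symmetrized noise, the likelihood the raw one. *)
Lemma likelihood_shift (l : R) (x : rvec R n) (h : tensor R d n -> \bar R) :
  unit_vec x -> measurable_fun setT h -> (forall w, 0 <= h w)%E ->
  (\int[wigner_tensor R d n]_W h (spike l (x, W)) =
   \int[G]_w (h (symmetrize w) * (likelihood l (x, w))%:E))%E.
Proof.
move=> ux mh h0; rewrite /wigner_tensor ge0_integral_pushforward//=; last first.
  apply: (measurableT_comp mh); apply: (measurableT_comp (@measurable_spike _ d n l)).
  exact: measurable_fun_pair.
have mhs : measurable_fun setT (fun w : tensor R d n => h (symmetrize w)).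
  by apply: (measurableT_comp mh); exact: measurable_symmetrize.
transitivity (\int[G]_w h (symmetrize (vadd _ w (vscale _ l (tensor_pow d x)))))%E.
  by apply: eq_integral => w _; rewrite symmetrize_vadd_tensor_pow.
rewrite (iid_cameron_martin s _ _ (fun w => h (symmetrize w)))//.
apply: eq_integral => w _; congr (_ * (expR _)%:E)%E.
rewrite !(dotpZl, dotpZr) dotp_tensor_pow ux expr1n -[s ^+ 2 *+ 2]mulr_natr s2/=.
by field; rewrite gt_eqF.
Qed.

(** Cameron-Martin for the constant 1 says that the exponential density has mass 1; the
    deterministic factor is then moved across. *)
Lemma gaussian_mgf (v : tensor R d n) :
  (\int[G]_w (expR (N / 2 * dotp v w))%:E = (expR (N / 4 * dotp v v))%:E)%E.
Proof.
have := iid_cameron_martin s _ v (cst 1%E) s0 (measurable_cst _) (fun=> lee01).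
rewrite integral_cst//= probability_setT mule1.
under eq_integral do rewrite mul1e.
have me : measurable_fun setT (fun w : tensor R d n => expR (N / 2 * dotp v w)).
  by apply: measurableT_comp => //; apply: measurable_funM => //; exact: measurable_dotp.
move=> E; transitivity ((expR (N / 4 * dotp v v))%:E *
  \int[G]_w (expR (dotp v w / s ^+ 2 - dotp v v / (s ^+ 2 *+ 2)))%:E)%E; last by rewrite -E mule1.
rewrite -ge0_integralZl_real ?expR_ge0//.
- apply: eq_integral => w _; rewrite -expRD; congr (expR _)%:E.
  by rewrite -[s ^+ 2 *+ 2]mulr_natr s2; field; rewrite gt_eqF.
- apply: measurableT_comp => //; apply: measurable_funB => //.
  by apply: measurable_funM => //; exact: measurable_dotp.
Qed.

(** For spiked noise the scalar product has mean l and variance 2/n, so the event is typical.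
    Including the unit norm makes the pair bounds hold at every point instead of almost
    everywhere. *)
Definition truncation_event (l delta : R) : set (rvec R n * tensor R d n) :=
  [set p | unit_vec p.1 /\ dotp (tensor_pow d p.1) p.2 <= l + delta].

Lemma measurable_unit_vec : measurable [set x : rvec R n | unit_vec x].
Proof.
have m := measurable_dotp n id id (@measurable_id _ (rvec R n) setT)
  (@measurable_id _ (rvec R n) setT).
by have := m measurableT [set 1] (measurable_set1 _); rewrite setTI.
Qed.

Lemma measurable_truncation_event l delta : measurable (truncation_event l delta).
Proof.
rewrite (_ : truncation_event l delta = (fst @^-1` [set x | unit_vec x]) `&`
  ((fun p : rvec R n * tensor R d n => dotp (tensor_pow d p.1) p.2) @^-1` `]-oo, l + delta])); last first.
  by apply/seteqP; split => p /=; rewrite in_itv.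
apply: measurableI.
  have mf : measurable_fun setT (@fst (rvec R n) (tensor R d n)) by exact: measurable_fst.
  by have := mf measurableT _ measurable_unit_vec; rewrite setTI.
by have := measurable_dotp_tensor_pow measurableT _ (measurable_itv `]-oo, l + delta]);
  rewrite setTI.
Qed.

Definition truncated (l delta : R) (p : rvec R n * tensor R d n) : R :=
  \1_(truncation_event l delta) p * likelihood l p.

Lemma measurable_truncated l delta : measurable_fun setT (truncated l delta).
Proof.
apply: measurable_funM; last exact: measurable_likelihood.
by apply: measurable_indic; exact: measurable_truncation_event.
Qed.

Lemma likelihood_ge0 l p : 0 <= likelihood l p. Proof. exact: expR_ge0. Qed.

Lemma truncated_ge0 l delta p : 0 <= truncated l delta p.
Proof. by rewrite mulr_ge0// likelihood_ge0. Qed.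

(** Crude in n, but it makes every integral in the abstract part finite. *)
Lemma truncated_bound l delta p : 0 <= l ->
  truncated l delta p <= expR (N / 2 * (l * (l + delta))).
Proof.
move=> l0; rewrite /truncated indicE.
have [/set_mem [_ hp]|_] := boolP (p \in truncation_event l delta); last by rewrite mul0r expR_ge0.
rewrite mul1r ler_expR ler_pM2l ?divr_gt0//.
have := sqr_ge0 l; have := ler_wpM2l l0 hp; lra.
Qed.

(* Chernoff bound for the event that truncation discards *)
Lemma truncation_error l delta x : 0 <= delta -> unit_vec x ->
  (\int[G]_w (likelihood l (x, w) * (1 - \1_(truncation_event l delta) (x, w)))%:E <=
   (expR (- (N * delta ^+ 2 / 4)))%:E)%E.
Proof.
move=> dl ux.
have mc : measurable_fun setT (fun w : tensor R d n =>
   expR (N / 2 * dotp (vscale _ (l + delta) (tensor_pow d x)) w)).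
  by apply: measurableT_comp => //; apply: measurable_funM => //; exact: measurable_dotp.
(* Off the event, [exp (N/2 delta (<x^{(x) d}, w> - l - delta))] exceeds 1; multiplying by it
   changes the tilt from l to l + delta and leaves this constant. *)
pose c := expR (- (N / 2 * (l ^+ 2 / 2 + delta * (l + delta)))).
apply: (@le_trans _ _ (\int[G]_w (c *
   expR (N / 2 * dotp (vscale _ (l + delta) (tensor_pow d x)) w))%:E)%E).
  apply: ge0_le_integral_EFin.
  - apply: measurable_funM; first by apply: (measurableT_comp (measurable_likelihood l)).
    apply: measurable_funB => //.
    have m : measurable_fun setT (\1_(truncation_event l delta) : _ -> R).
      by apply: measurable_indic; exact: measurable_truncation_event.
    by apply: (measurableT_comp m).
  - exact: measurable_funM.
  - move=> w; apply: mulr_ge0; first exact: likelihood_ge0.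
    by rewrite subr_ge0 indicE; case: (_ \in truncation_event l delta).
  move=> w; rewrite indicE; have [hw|/negP hw] := boolP ((x, w) \in truncation_event l delta).
    by rewrite subrr mulr0 mulr_ge0 ?expR_ge0.
  rewrite subr0 mulr1 -expRD ler_expR dotpZl/=.
  have {}hw : l + delta < dotp (tensor_pow d x) w.
    by rewrite ltNge; apply/negP => h; apply: hw; apply/mem_set; split.
  rewrite -[X in _ <= X + _]mulrN -mulrDr ler_pM2l ?divr_gt0//.
  by have := ler_wpM2l dl (ltW hw); lra.
rewrite ge0_integralZl_real ?expR_ge0//.
rewrite gaussian_mgf -EFinM lee_fin -expRD ler_expR !(dotpZl, dotpZr) dotp_tensor_pow ux expr1n.
by rewrite le_eqVlt; apply/orP; left; apply/eqP; field.
Qed.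

(** Each indicator is at most [exp (N/2 a (l + delta - <x^{(x) d}, w>))]. This lowers the
    coefficient of both tensor powers to l - a, and [gaussian_mgf] evaluates what remains. *)
Lemma truncated_pair l delta a x y : 0 <= a -> 
  (\int[G]_w (truncated l delta (x, w) * truncated l delta (y, w))%:E <=
   (expR (N / 2 * ((l - a) ^+ 2 * (1 + dotp x y ^+ d) - l ^+ 2 + 2 * a * (l + delta))))%:E)%E.
Proof.
move=> a0.
have mt z : measurable_fun setT (fun w => truncated l delta (z, w)).
  by apply: (measurableT_comp (measurable_truncated l delta)).
have [uxy|nuxy] := pselect (unit_vec x /\ unit_vec y); last first.
  rewrite integral0_eq ?lee_fin ?expR_ge0// => w _.
  rewrite /truncated !indicE; have [/set_mem[ux _]|_] := boolP ((x, w) \in truncation_event l delta); last by rewrite !mul0r.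
  have [/set_mem[uy _]|_] := boolP ((y, w) \in truncation_event l delta); last by rewrite mul0r mulr0.
  by exfalso; apply: nuxy.
case: uxy => ux uy.
pose v := vscale _ (l - a) (vadd _ (tensor_pow d x) (tensor_pow d y)).
have mc : measurable_fun setT (fun w : tensor R d n => expR (N / 2 * dotp v w)).
  by apply: measurableT_comp => //; apply: measurable_funM => //; exact: measurable_dotp.
pose c := expR (N / 2 * (2 * a * (l + delta) - l ^+ 2)).
apply: (@le_trans _ _ (\int[G]_w (c * expR (N / 2 * dotp v w))%:E)%E).
  apply: ge0_le_integral_EFin.
  - exact: measurable_funM.
  - exact: measurable_funM.
  - by move=> w; rewrite mulr_ge0 ?truncated_ge0.
  move=> w; rewrite /truncated !indicE.
  have [/set_mem[_ /= hx]|_] := boolP ((x, w) \in truncation_event l delta); last by rewrite !mul0r mulr_ge0 ?expR_ge0.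
  have [/set_mem[_ /= hy]|_] := boolP ((y, w) \in truncation_event l delta); last by rewrite mul0r mulr0 mulr_ge0 ?expR_ge0.
  rewrite !mul1r -!expRD ler_expR -!mulrDr ler_pM2l ?divr_gt0//= dotpZl dotpDl.
  by have := ler_wpM2l a0 hx; have := ler_wpM2l a0 hy; lra.
rewrite ge0_integralZl_real ?expR_ge0//.
rewrite gaussian_mgf -EFinM lee_fin -expRD ler_expR !(dotpZl, dotpZr, dotpDl, dotpDr).
rewrite !dotp_tensor_pow ux uy (dotpC _ y x) expr1n.
by rewrite le_eqVlt; apply/orP; left; apply/eqP; field.
Qed.

End likelihood.

(** * Overlap moments *)

Section tail_rate.
Context {R : realType}.

Definition tail_rate (d : nat) (r : R) := r ^+ d / (1 + r ^+ d).

(** The map p -> p/(1 + p) is 1-Lipschitz for p >= 0, and the d-th power is d-Lipschitz on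
    [0, 1]. *)
Lemma tail_rate_lipschitz d (r v : R) : 0 <= r -> r <= v -> v <= 1 ->
  tail_rate d v - tail_rate d r <= d%:R * (v - r).
Proof.
move=> r0 rv v1; have v0 := le_trans r0 rv.
have X k : 0 <= r ^+ k <= v ^+ k by rewrite exprn_ge0//= lerXn2r.
apply: (@le_trans _ _ (v ^+ d - r ^+ d)).
  have /andP[rd vd] := X d; rewrite /tail_rate.
  set p := r ^+ d in rd vd *; set q := v ^+ d in vd *.
  have -> : q / (1 + q) - p / (1 + p) = (q - p) / ((1 + q) * (1 + p)).
    by field; rewrite !gt_eqF//; lra.
  rewrite ler_pdivrMr ?mulr_gt0//; try lra.
  by rewrite -[leLHS]mulr1 ler_wpM2l; nra.
elim: d => [|d IH]; first by rewrite !expr0 subrr mul0r.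
rewrite !exprS -natr1; have /andP[rd vd] := X d.
have rd1 : r ^+ d <= 1 by rewrite (le_trans vd)// exprn_ile1.
nra.
Qed.

Lemma tail_rate_homo d (r v : R) : 0 <= r -> r <= v -> tail_rate d r <= tail_rate d v.
Proof.
move=> r0 rv; have v0 := le_trans r0 rv.
have rd : 0 <= r ^+ d by rewrite exprn_ge0.
have vd : r ^+ d <= v ^+ d by rewrite lerXn2r.
rewrite /tail_rate; set p := r ^+ d in rd vd *; set q := v ^+ d in vd *.
rewrite ler_pdivrMr ?ltr_wpDr// mulrAC ler_pdivlMr; nra.
Qed.

Lemma tail_rate_gt0 d (r : R) : 0 < r -> 0 < tail_rate d r.
Proof. by move=> r0; rewrite divr_gt0 ?addr_gt0 ?exprn_gt0. Qed.

End tail_rate.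

Section exponential_moments.
Context {dd : measure_display} {T : measurableType dd} {R : realType}.
Variables (P : probability T R) (u : T -> R).
Hypotheses (mu : measurable_fun setT u) (u0 : forall x, 0 <= u x).

Let measurable_level r : measurable [set x | r <= u x].
Proof.
have := mu measurableT _ (measurable_itv `[r, +oo[); rewrite setTI.
by rewrite (_ : _ @^-1` _ = [set x | r <= u x])//; apply/seteqP; split => x /=;
  rewrite in_itv/= andbT.
Qed.

(** A finite layer-cake estimate: domination by steps in u turns tail bounds into a moment bound.
    Both ranges of overlaps are treated this way. *)
Lemma step_bound (F : T -> R) (m : nat) (c r b : 'I_m -> R) :
  measurable_fun setT F -> (forall x, 0 <= F x) -> (forall k, 0 <= c k) ->
  (forall x, F x <= \sum_k c k * (r k <= u x)%R%:R) ->
  (forall k, (c k)%:E * P [set x | r k <= u x]%R <= (b k)%:E)%E ->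
  (\int[P]_x (F x)%:E <= (\sum_k b k)%:E)%E.
Proof.
move=> mF F0 c0 Fc cb.
have mi k : measurable_fun setT (fun x => \1_[set x | r k <= u x] x : R).
  by apply: measurable_indic; exact: measurable_level.
have E x k : (r k <= u x)%R%:R = \1_[set x | r k <= u x] x :> R.
  by rewrite indicE; congr (nat_of_bool _)%:R; apply/idP/idP => [h|/set_mem//]; apply/mem_set.
apply: (@le_trans _ _ (\int[P]_x (\sum_k c k * \1_[set x | r k <= u x] x)%:E)%E).
  apply: ge0_le_integral_EFin => //.
    by apply: measurable_sum => k; exact: measurable_funM.
  by move=> x; rewrite (le_trans (Fc x))// ler_sum// => k _; rewrite E.
under eq_integral do rewrite -sumEFin.
rewrite ge0_integral_sum//; last 2 first.
- by move=> k; apply/measurable_EFinP; exact: measurable_funM.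
- by move=> k x _; rewrite lee_fin mulr_ge0.
rewrite -sumEFin; apply: lee_sum => k _.
have ml := measurable_level (r k).
by rewrite ge0_integralZl_real// integral_indic// setIT.
Qed.

(* Layers [k <= n u^2 < k + 1]: subgaussian tails make the sum geometric. *)
Lemma small_overlap_moment (n : nat) (kappa a C t0 : R) : (0 < n)%N ->
  0 <= a -> a < kappa -> 0 <= C -> 0 < t0 -> t0 <= 1 ->
  (forall r, 0 <= r <= t0 ->
    (P [set x | r <= u x]%R <= (C * expR (- (n%:R * kappa * r ^+ 2)))%:E)%E) ->
  (\int[P]_x (expR (n%:R * a * u x ^+ 2) * \1_(`]-oo, t0]) (u x))%:E <=
   (C * expR a / (1 - expR (a - kappa)))%:E)%E.
Proof.
move=> n0 a0 ak C0 t00 t01 tail.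
have N0 : 0 < n%:R :> R by rewrite ltr0n.
(* The level where [n u^2 = k]; n + 1 levels suffice since u <= 1 here. On layer k the integrand is
   at most [expR (a * k.+1%:R)], and levels above [t0], where no tail bound is given, get
   coefficient 0. *)
pose r (k : 'I_n.+1) : R := Num.sqrt (k%:R / n%:R).
pose c (k : 'I_n.+1) : R := if r k <= t0 then expR (a * k.+1%:R) else 0.
pose rho := expR (a - kappa).
have r2 k : n%:R * r k ^+ 2 = k%:R.
  by rewrite sqr_sqrtr ?divr_ge0// mulrCA divff ?mulr1// gt_eqF.
have rho1 : rho < 1 by rewrite expR_lt1 subr_lt0.
have rho0 : 0 < rho by rewrite expR_gt0.
apply: (@le_trans _ _ (\sum_(k < n.+1) (C * expR a * rho ^+ k))%:E).
  apply: (step_bound _ _ c r).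
  - apply: measurable_funM.
      apply: measurableT_comp => //; apply: measurable_funM => //.
      exact: measurable_funX.
    have m : measurable_fun setT (\1_(`]-oo, t0]) : R -> R) by apply: measurable_indic.
    exact: (measurableT_comp m mu).
  - by move=> x; rewrite mulr_ge0 ?expR_ge0.
  - by move=> k; rewrite /c; case: ifP => // _; rewrite expR_ge0.
  - move=> x; rewrite indicE.
    have [/set_mem /=|_] := boolP (u x \in _); last first.
      rewrite mulr0; apply: sumr_ge0 => k _; rewrite mulr_ge0// /c.
      by case: ifP => // _; rewrite expR_ge0.
    rewrite in_itv/= => ut0; rewrite mulr1.
    have nu0 : 0 <= n%:R * u x ^+ 2 by rewrite mulr_ge0// sqr_ge0.
    have /andP[k1 k2] := truncn_itv nu0; set k := Num.truncn _ in k1 k2.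
    have u1 : u x ^+ 2 <= 1 by rewrite expr_le1// (le_trans ut0).
    have kn : (k < n.+1)%N.
      rewrite ltnS -(ler_nat R) (le_trans k1)//.
      by rewrite -[leRHS]mulr1 ler_pM2l.
    rewrite (bigD1 (Ordinal kn))//= -[leLHS]addr0; apply: lerD; last first.
      apply: sumr_ge0 => j _; rewrite mulr_ge0// /c.
      by case: ifP => // _; rewrite expR_ge0.
    have rku : r (Ordinal kn) <= u x.
      rewrite /r/= -(ger0_norm (u0 x)) -sqrtr_sqr ler_wsqrtr//.
      by rewrite ler_pdivrMr// mulrC.
    rewrite /c rku (le_trans rku ut0) mulr1 ler_expR/= mulrAC mulrC.
    by apply: ler_wpM2l => //; exact: ltW.
  - move=> k; rewrite /c; case: ifP => [rt|_]; last first.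
      by rewrite mul0e lee_fin !mulr_ge0 ?expR_ge0// exprn_ge0// ltW.
    have rk0 : 0 <= r k by rewrite sqrtr_ge0.
    have ck0 : (0 <= (expR (a * k.+1%:R))%:E)%E by rewrite lee_fin expR_ge0.
    have rkt : 0 <= r k <= t0 by rewrite rk0 rt.
    apply: (le_trans (lee_wpmul2l ck0 (tail (r k) rkt))).
    have -> : n%:R * kappa * r k ^+ 2 = kappa * k%:R by rewrite -(r2 k); ring.
    have -> : rho ^+ k = expR ((a - kappa) * k%:R) by rewrite expRM_natr.
    rewrite -EFinM lee_fin mulrCA -mulrA ler_wpM2l// -!expRD ler_expR -(natr1 k).
    by rewrite le_eqVlt; apply/orP; left; apply/eqP; ring.
rewrite lee_fin -mulr_sumr ler_wpM2l ?mulr_ge0 ?expR_ge0//.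
rewrite -[leRHS]mul1r ler_pdivlMr ?subr_gt0// mulrC.
rewrite -/rho; have E := subrX1 rho n.+1.
have p0 : 0 <= rho ^+ n.+1 by rewrite exprn_ge0// ltW.
by set S := \sum_(_ < _) _ in E *; lra.
Qed.


Lemma measurable_tail_rate d : measurable_fun setT (fun x => tail_rate d (u x)).
Proof.
apply: (eq_measurable_fun (fun x => u x ^+ d * expR (- ln (1 + u x ^+ d)))) => [x _|].
  by rewrite expRN lnK// posrE ltr_wpDr// exprn_ge0.
have mud : measurable_fun setT (fun x => u x ^+ d) by exact: measurable_funX.
apply: measurable_funM => //; apply: measurableT_comp => //; apply: measurableT_comp => //.
by apply: measurableT_comp; [exact: measurable_ln|exact: measurable_funD].
Qed.

(* On the grid [k / N] the tail exponent [- cs * tail_rate] beats the growth *)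
(* [c * tail_rate] by at least [gamma], up to discretization. *)
Lemma large_overlap_moment (n N d : nat) (c cs e1 e2 gamma t0 : R) : (0 < N)%N ->
  0 <= c -> c < cs -> 0 < t0 -> t0 <= 1 ->
  e1 + e2 + cs * d%:R / N%:R + gamma <= (cs - c) * tail_rate d t0 ->
  (forall r, 0 <= r < 1 ->
    (P [set x | r <= u x]%R <= (2 * expR (- (n%:R * (cs * tail_rate d r - e2))))%:E)%E) ->
  (\int[P]_x (expR (n%:R * (c * tail_rate d (u x) + e1)) * \1_(`]t0, 1]) (u x))%:E <=
   (N%:R * (2 * expR (- (n%:R * gamma))))%:E)%E.
Proof.
move=> N0 c0 ccs t00 t01 hgamma tail.
have N0' : 0 < N%:R :> R by rewrite ltr0n.
(* In each cell the tail is taken at the left end, which stays below 1, and the growth at the right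
   end; cells ending below [t0] are dropped. *)
pose r (k : 'I_N) : R := k%:R / N%:R.
pose r' (k : 'I_N) : R := k.+1%:R / N%:R.
pose cc (k : 'I_N) : R := if t0 <= r' k then expR (n%:R * (c * tail_rate d (r' k) + e1)) else 0.
have cc0 k : 0 <= cc k by rewrite /cc; case: ifP => // _; rewrite expR_ge0.
have -> : N%:R * (2 * expR (- (n%:R * gamma))) = \sum_(k < N) 2 * expR (- (n%:R * gamma)).
  by rewrite sumr_const card_ord mulr_natl.
apply: (step_bound _ _ cc r) => //.
- apply: measurable_funM.
    apply: measurableT_comp => //; apply: measurable_funM => //.
    apply: measurable_funD => //; apply: measurable_funM => //.
    exact: measurable_tail_rate.
  have m : measurable_fun setT (\1_(`]t0, 1]) : R -> R) by apply: measurable_indic.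
  exact: (measurableT_comp m mu).
- move=> x; rewrite indicE.
  have [/set_mem /=|_] := boolP (u x \in _); last first.
    by rewrite mulr0; apply: sumr_ge0 => k _; rewrite mulr_ge0.
  rewrite in_itv/= mulr1 => /andP[t0u u1].
  have [k [ku uk]] : exists k : 'I_N, r k <= u x /\ u x <= r' k.
    have Nu0 : 0 <= N%:R * u x by rewrite mulr_ge0.
    have /andP[k1 k2] := truncn_itv Nu0; set k := Num.truncn _ in k1 k2.
    have [kN|Nk] := ltnP k N.
      exists (Ordinal kN); rewrite /r /r'/= ler_pdivrMr// ler_pdivlMr// mulrC k1.
      by split => //; exact: ltW.
    (* Here u = 1, which belongs to the last cell, closed on the right. *)
    have pN : (N.-1 < N)%N by rewrite prednK.
    exists (Ordinal pN); rewrite /r /r'/= prednK// divff ?gt_eqF//; split => //.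
    rewrite ler_pdivrMr// mulrC (le_trans _ k1)// ler_nat.
    by rewrite (leq_trans _ Nk)// leq_pred.
  rewrite (bigD1 k)//= -[leLHS]addr0; apply: lerD; last first.
    by apply: sumr_ge0 => j _; rewrite mulr_ge0.
  rewrite ku mulr1 /cc (le_trans (ltW t0u) uk) ler_expR ler_wpM2l//.
  by rewrite lerD2r ler_wpM2l// tail_rate_homo.
- move=> k; rewrite /cc; case: ifP => [t0r|_]; last first.
    by rewrite mul0e lee_fin mulr_ge0 ?expR_ge0.
  have rk : 0 <= r k < 1.
    by rewrite divr_ge0//= ltr_pdivrMr// mul1r ltr_nat.
  have ck0 : (0 <= (expR (n%:R * (c * tail_rate d (r' k) + e1)))%:E)%E by rewrite lee_fin expR_ge0.
  apply: (le_trans (lee_wpmul2l ck0 (tail (r k) rk))).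
  rewrite -EFinM lee_fin mulrCA ler_wpM2l// -expRD ler_expR -mulrN -mulrDr -mulrN ler_wpM2l//.
  have rr' : r' k - r k = N%:R^-1.
    by rewrite /r /r' -mulrBl -natr1 addrC addKr mul1r.
  have r'1 : r' k <= 1 by rewrite ler_pdivrMr// mul1r ler_nat.
  have rr : r k <= r' k by rewrite -subr_ge0 rr' invr_ge0.
  have /andP[r0 _] := rk.
  have := tail_rate_lipschitz d _ _ r0 rr r'1; rewrite rr'.
  have := tail_rate_homo d _ _ (ltW t00) t0r.
  move: hgamma; rewrite -mulrA.
  set q := d%:R / N%:R; set g0 := tail_rate d t0; set g1 := tail_rate d (r' k).
  set g2 := tail_rate d (r k) => hgamma h1 h2.
  have cs0 : 0 <= cs by rewrite (le_trans c0)// ltW.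
  have cc' : 0 <= cs - c by rewrite subr_ge0 ltW.
  have := ler_wpM2l cs0 h2; have := ler_wpM2l cc' h1; lra.
Qed.

End exponential_moments.

(** * Small overlaps when d >= 3 *)

Section cubic_overlap.
Context {R : realType}.

Lemma expR_le_1Dxexp (y : R) : expR y <= 1 + y * expR y.
Proof.
have := expR_ge1Dx (- y); rewrite -(ler_pM2r (expR_gt0 y)) mulrDl mul1r -expRD addNr expR0.
lra.
Qed.

Lemma expR_ge_half_sqr (y : R) : 0 <= y -> y ^+ 2 / 2 <= expR y.
Proof.
by move=> y0; have := @expR_ge1Dxn R y 1 y0; rewrite /= !factS fact0; lra.
Qed.

Lemma expr_le_cubic (d : nat) (v t : R) : (3 <= d)%N -> 0 <= v -> v <= t -> t <= 1 ->
  v ^+ d <= v ^+ 3 /\ v ^+ d <= t * v ^+ 2.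
Proof.
move=> d3 v0 vt t1.
have h : v ^+ d <= v ^+ 3 by rewrite ler_wiXn2l// (le_trans vt).
split=> //; apply: (le_trans h); rewrite exprS.
by apply: ler_wpM2r => //; rewrite sqr_ge0.
Qed.

(** Start from [exp y <= 1 + y exp y] with [y <= n c v^3], and split
    [v^3 <= theta/2 v^2 + v^4/(2 theta)]. The factors [n v^2] and [n^2 v^4] are absorbed by
    [exp (a n v^2)], leaving 1/n in the second term. The coefficient is thus small for theta small
    and then n large. *)
Lemma expR_cubic_le (n d : nat) (c a theta v t : R) : (0 < n)%N -> (3 <= d)%N ->
  0 <= c -> 0 < a -> 0 < theta -> 0 <= v -> v <= t -> t <= 1 ->
  expR (n%:R * (c * v ^+ d)) <=
  1 + (c * theta / (2 * a) + c / (theta * a ^+ 2 * n%:R)) *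
      expR (n%:R * (a + c * t) * v ^+ 2).
Proof.
move=> n0 d3 c0 a0 th0 v0 vt t1.
have N0 : 0 < n%:R :> R by rewrite ltr0n.
have [h3 h2] := expr_le_cubic d v t d3 v0 vt t1.
apply: (le_trans (expR_le_1Dxexp _)); rewrite lerD2l.
have vd0 : 0 <= v ^+ d by rewrite exprn_ge0.
have y0 : 0 <= n%:R * (c * v ^+ d) by rewrite !mulr_ge0// ltW.
apply: (@le_trans _ _ (n%:R * (c * v ^+ 3) * expR (n%:R * (c * (t * v ^+ 2))))).
  apply: ler_pM; rewrite ?expR_ge0//.
    by rewrite ler_wpM2l ?(ltW N0)// ler_wpM2l.
  by rewrite ler_expR ler_wpM2l ?(ltW N0)// ler_wpM2l.
have -> : expR (n%:R * (a + c * t) * v ^+ 2) =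
   expR (a * n%:R * v ^+ 2) * expR (n%:R * (c * (t * v ^+ 2))).
  by rewrite -expRD; congr expR; ring.
rewrite [leRHS]mulrA ler_wpM2r ?expR_ge0//.
set z := a * n%:R * v ^+ 2.
have z0 : 0 <= z by rewrite !mulr_ge0 ?sqr_ge0// ltW.
have e1 : z <= expR z by have := expR_ge1Dx z; lra.
have e2 := expR_ge_half_sqr z z0.
apply: (@le_trans _ _ (c * theta / (2 * a) * z + c / (theta * a ^+ 2 * n%:R) * (z ^+ 2 / 2))).
  have -> : c * theta / (2 * a) * z = c * n%:R * (theta / 2 * v ^+ 2).
    by rewrite /z; field; rewrite gt_eqF.
  have -> : c / (theta * a ^+ 2 * n%:R) * (z ^+ 2 / 2) = c * n%:R * (v ^+ 4 / (2 * theta)).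
    by rewrite /z; field; rewrite !gt_eqF.
  rewrite -mulrDr mulrCA mulrA ler_wpM2l// ?mulr_ge0// ?(ltW N0)//.
  rewrite -subr_ge0.
  have -> : theta / 2 * v ^+ 2 + v ^+ 4 / (2 * theta) - v ^+ 3 =
     (v * (theta - v)) ^+ 2 / (2 * theta) by field; rewrite gt_eqF.
  by rewrite divr_ge0 ?sqr_ge0// mulr_ge0// ltW.
rewrite [leRHS]mulrDl; apply: lerD; apply: ler_wpM2l => //.
  by rewrite divr_ge0 ?mulr_ge0// ltW.
by rewrite divr_ge0 ?mulr_ge0 ?sqr_ge0// ltW.
Qed.

(** The gain 1/n comes from [a n v^2 <= exp (a n v^2)]. *)
Lemma sqr_expR_cubic_le (n d : nat) (c a v t : R) : (0 < n)%N -> (3 <= d)%N ->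
  0 <= c -> 0 < a -> 0 <= v -> v <= t -> t <= 1 ->
  v ^+ 2 * expR (n%:R * (c * v ^+ d)) <=
  (a * n%:R)^-1 * expR (n%:R * (a + c * t) * v ^+ 2).
Proof.
move=> n0 d3 c0 a0 v0 vt t1.
have N0 : 0 < n%:R :> R by rewrite ltr0n.
have [_ h2] := expr_le_cubic d v t d3 v0 vt t1.
have -> : expR (n%:R * (a + c * t) * v ^+ 2) =
   expR (a * n%:R * v ^+ 2) * expR (n%:R * (c * (t * v ^+ 2))).
  by rewrite -expRD; congr expR; ring.
rewrite [leRHS]mulrA; apply: ler_pM; rewrite ?sqr_ge0 ?expR_ge0//.
  rewrite ler_pdivlMl ?mulr_gt0//.
  by have := expR_ge1Dx (a * n%:R * v ^+ 2); lra.
by rewrite ler_expR ler_wpM2l ?(ltW N0)// ler_wpM2l.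
Qed.

End cubic_overlap.

Section cubic_moments.
Context {dd : measure_display} {T : measurableType dd} {R : realType}.
Variables (P : probability T R) (u : T -> R).
Hypotheses (mu : measurable_fun setT u) (u0 : forall x, 0 <= u x).
Variables (n d : nat) (c a kappa C t0 : R).
Hypotheses (n0 : (0 < n)%N) (d3 : (3 <= d)%N) (c0 : 0 <= c) (a0 : 0 < a).
Hypotheses (ak : a + c * t0 < kappa) (C0 : 0 <= C) (t00 : 0 < t0) (t01 : t0 <= 1).
Hypothesis tail : forall r, 0 <= r <= t0 ->
  (P [set x | r <= u x]%R <= (C * expR (- (n%:R * kappa * r ^+ 2)))%:E)%E.

(** The constant of [small_overlap_moment] at exponent [a + c * t0]: the part [c * t0] pays for
    [v^d <= t0 v^2], the part [a] for the absorbed powers of v. *)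
Let K := C * expR (a + c * t0) / (1 - expR (a + c * t0 - kappa)).

Let E x := expR (n%:R * (a + c * t0) * u x ^+ 2) * \1_(`]-oo, t0]) (u x).

Let m1 : measurable_fun setT (fun x => \1_(`]-oo, t0]) (u x) : R).
Proof.
have m : measurable_fun setT (\1_(`]-oo, t0]) : R -> R) by apply: measurable_indic.
exact: (measurableT_comp m mu).
Qed.

Let mE : measurable_fun setT E.
Proof.
apply: measurable_funM => //.
apply: measurableT_comp => //; apply: measurable_funM => //.
exact: measurable_funX.
Qed.

Let E0 x : 0 <= E x. Proof. by rewrite mulr_ge0 ?expR_ge0. Qed.

Let intE : (\int[P]_x (E x)%:E <= K%:E)%E.
Proof.
apply: (small_overlap_moment P u mu u0 n kappa (a + c * t0) C t0) => //.
by rewrite addr_ge0 ?(ltW a0)// mulr_ge0// ltW.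
Qed.

Let mud : measurable_fun setT (fun x => expR (n%:R * (c * u x ^+ d))).
Proof.
apply: measurableT_comp => //; apply: measurable_funM => //; apply: measurable_funM => //.
exact: measurable_funX.
Qed.

Lemma small_overlap_cubic (theta : R) : 0 < theta ->
  (\int[P]_x (expR (n%:R * (c * u x ^+ d)) * \1_(`]-oo, t0]) (u x))%:E <=
   (1 + (c * theta / (2 * a) + c / (theta * a ^+ 2 * n%:R)) * K)%:E)%E.
Proof.
move=> th0; set A := _ + c / _.
have A0 : 0 <= A.
  rewrite addr_ge0// divr_ge0 ?mulr_ge0 ?sqr_ge0//; exact: ltW.
apply: (@le_trans _ _ (\int[P]_x (1 + A * E x)%:E)%E).
  apply: ge0_le_integral_EFin.
  - exact: measurable_funM.
  - by apply: measurable_funD => //; exact: measurable_funM.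
  - by move=> x; rewrite mulr_ge0 ?expR_ge0.
  move=> x; rewrite /E indicE; have [/set_mem/=|_] := boolP (u x \in _); last first.
    by rewrite !mulr0 addr0.
  by rewrite in_itv/= !mulr1 => ut; exact: expR_cubic_le.
rewrite ge0_integralD_EFin//; first last.
- by move=> x; rewrite mulr_ge0.
- exact: measurable_funM.
rewrite integral_cst_prob ge0_integralZl_real//.
have -> : (1 + A * K)%:E = (1%:E + A%:E * K%:E)%E by [].
by apply: leeD => //; apply: lee_wpmul2l.
Qed.

Lemma small_overlap_square :
  (\int[P]_x (u x ^+ 2 * (expR (n%:R * (c * u x ^+ d)) * \1_(`]-oo, t0]) (u x)))%:E <=
   ((a * n%:R)^-1 * K)%:E)%E.
Proof.
have A0 : 0 <= (a * n%:R)^-1 by rewrite invr_ge0 mulr_ge0// ltW.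
apply: (@le_trans _ _ (\int[P]_x ((a * n%:R)^-1 * E x)%:E)%E).
  apply: ge0_le_integral_EFin.
  - by apply: measurable_funM; [exact: measurable_funX|exact: measurable_funM].
  - exact: measurable_funM.
  - by move=> x; rewrite !mulr_ge0 ?sqr_ge0 ?expR_ge0.
  move=> x; rewrite /E indicE; have [/set_mem/=|_] := boolP (u x \in _); last first.
    by rewrite !mulr0.
  by rewrite in_itv/= !mulr1 => ut; exact: sqr_expR_cubic_le.
rewrite ge0_integralZl_real// EFinM.
by apply: lee_wpmul2l.
Qed.

End cubic_moments.

(** * Inequalities in fixed dimension *)

Section spiked_model.
Context {R : realType}.
Variables (d n : nat) (n_gt0 : (0 < n)%N) (l delta : R).
Hypotheses (l0 : 0 <= l) (delta0 : 0 <= delta).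
Variable X : probability (rvec R n) R.
Hypothesis hX : X [set x | unit_vec x] = 1%E.
Local Notation G := (iid (normal_prob (0 : R) (Num.sqrt (2 / n%:R) : R))
                         #|{: {ffun 'I_d -> 'I_n}}|).
Local Notation W := (wigner_tensor R d n).
Local Notation K := (truncated d n l delta).
Local Notation err := (expR (- (n%:R * delta ^+ 2 / 4))).
Local Open Scope ereal_scope.

Lemma ae_unit_vec : {ae X, forall x, unit_vec x}.
Proof.
exists (~` [set x | unit_vec x]); split => //.
- by apply: measurableC; exact: measurable_unit_vec.
- rewrite probability_setC; last exact: measurable_unit_vec.
  by rewrite [X in 1 - X]hX subee.
Qed.

Let mK : measurable_fun setT K. Proof. exact: measurable_truncated. Qed.
Let mL : measurable_fun setT (likelihood d n l : _ -> R).
Proof. exact: measurable_likelihood. Qed.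

Let msym {H : rvec R n * tensor R d n -> R} : measurable_fun setT H ->
  measurable_fun setT (fun p : rvec R n * tensor R d n => H (p.1, symmetrize p.2)).
Proof.
move=> mH; apply: (measurableT_comp mH); apply: measurable_fun_pair => //.
exact: (measurableT_comp (@measurable_symmetrize _ d n)).
Qed.

Let mspk {H : rvec R n * tensor R d n -> R} : measurable_fun setT H ->
  measurable_fun setT (fun p : rvec R n * tensor R d n => H (p.1, spike l p)).
Proof.
move=> mH; apply: (measurableT_comp mH); exact: measurable_fun_pair.
Qed.

(** Tonelli, then [likelihood_shift] for almost every x, as the prior charges only unit vectors. *)
Lemma integral_spiked (H : rvec R n * tensor R d n -> R) :
  measurable_fun setT H -> (forall p, 0 <= H p)%R ->
  \int[X \x W]_p (H (p.1, spike l p))%:E =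
  \int[X]_x \int[G]_w (H (x, symmetrize w) * likelihood d n l (x, w))%:E.
Proof.
move=> mH H0; have mHs := mspk mH; have mHy := msym mH.
have mHL : measurable_fun setT (fun p : rvec R n * tensor R d n =>
    (H (p.1, symmetrize p.2) * likelihood d n l p)%R) by exact: measurable_funM.
have HL0 p : 0 <= (H (p.1, symmetrize p.2) * likelihood d n l p)%:E.
  by rewrite lee_fin mulr_ge0// likelihood_ge0.
have mHse : measurable_fun setT (fun p : rvec R n * tensor R d n => (H (p.1, spike l p))%:E).
  exact/measurable_EFinP.
have H0e (p : rvec R n * tensor R d n) : 0 <= (H (p.1, spike l p))%:E by rewrite lee_fin.
rewrite (fubini_tonelli1 (m1 := X) (m2 := W) _ mHse H0e).
apply: (ge0_ae_eq_integral measurableT).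
- exact: (measurable_fun_fubini_tonelli_F (m2 := W) _ mHse H0e).
- apply: (measurable_fun_fubini_tonelli_F (m2 := G)
    (fun p => (H (p.1, symmetrize p.2) * likelihood d n l p)%:E)) => //.
  exact/measurable_EFinP.
- by move=> x _; apply: integral_ge0 => w _; rewrite lee_fin.
- by move=> x _; apply: integral_ge0 => w _; exact: (HL0 (x, w)).
apply: filterS ae_unit_vec => x ux _.
rewrite /fubini_F/= (likelihood_shift d n n_gt0 l x (fun T => (H (x, T))%:E))//.
- by apply/measurable_EFinP; apply: (measurableT_comp mH).
- by move=> w; rewrite lee_fin.
Qed.

(** The likelihood is its truncation plus a discarded part; on the latter H is at most 1 and
    [truncation_error] applies. *)
Lemma integral_spiked_le (H : rvec R n * tensor R d n -> R) :
  measurable_fun setT H -> (forall p, 0 <= H p)%R ->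
  (forall x T, unit_vec x -> H (x, T) <= 1)%R ->
  \int[X \x W]_p (H (p.1, spike l p))%:E <=
  \int[X]_x \int[G]_w (K (x, w) * H (x, symmetrize w))%:E + err%:E.
Proof.
move=> mH H0 H1; rewrite integral_spiked//; have mHy := msym mH.
have mHL : measurable_fun setT (fun p : rvec R n * tensor R d n =>
    (H (p.1, symmetrize p.2) * likelihood d n l p)%R) by exact: measurable_funM.
have mKH : measurable_fun setT (fun p : rvec R n * tensor R d n =>
    (K p * H (p.1, symmetrize p.2))%R) by exact: measurable_funM.
have KH0 p : (0 <= K p * H (p.1, symmetrize p.2))%R by rewrite mulr_ge0// truncated_ge0.
have HL0 p : 0 <= (H (p.1, symmetrize p.2) * likelihood d n l p)%:E.
  by rewrite lee_fin mulr_ge0// likelihood_ge0.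
have KH0e p : 0 <= (K p * H (p.1, symmetrize p.2))%:E by rewrite lee_fin.
have mKHe : measurable_fun setT (fun p : rvec R n * tensor R d n =>
    (K p * H (p.1, symmetrize p.2))%:E) by exact/measurable_EFinP.
have mFKH := measurable_fun_fubini_tonelli_F (m2 := G) _ mKHe KH0e.
rewrite -(integral_cst_prob X err) -ge0_integralD//; last first.
  by move=> x _; apply: integral_ge0 => w _; rewrite lee_fin (KH0 (x, w)).
apply: (ae_ge0_le_integral measurableT).
- by move=> x _; apply: integral_ge0 => w _; exact: (HL0 (x, w)).
- apply: (measurable_fun_fubini_tonelli_F (m2 := G)
    (fun p => (H (p.1, symmetrize p.2) * likelihood d n l p)%:E)) => //.
  exact/measurable_EFinP.
- move=> x _; rewrite adde_ge0 ?lee_fin ?expR_ge0//.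
  by apply: integral_ge0 => w _; rewrite lee_fin (KH0 (x, w)).
- exact: emeasurable_funD.
apply: filterS ae_unit_vec => x ux _.
apply: (le_trans _ (leeD2l _ (truncation_error d n n_gt0 l delta x delta0 ux))).
have mg : measurable_fun setT (\1_(truncation_event d n l delta) : _ -> R).
  by apply: measurable_indic; exact: measurable_truncation_event.
have mKHx : measurable_fun setT (fun w => K (x, w) * H (x, symmetrize w))%R.
  exact: (measurableT_comp mKH).
have mex : measurable_fun setT (fun w =>
   likelihood d n l (x, w) * (1 - \1_(truncation_event d n l delta) (x, w)))%R.
  apply: measurable_funM; first exact: (measurableT_comp mL).
  by apply: measurable_funB => //; exact: (measurableT_comp mg).
have e0 w : (0 <= likelihood d n l (x, w) * (1 - \1_(truncation_event d n l delta) (x, w)))%R.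
  apply: mulr_ge0; first exact: likelihood_ge0.
  by rewrite subr_ge0 indicE; case: (_ \in truncation_event d n l delta).
rewrite -ge0_integralD_EFin//.
apply: ge0_le_integral_EFin.
- have mx : measurable_fun setT (fun w : tensor R d n => (x, w)) by exact: measurable_fun_pair.
  exact: (measurableT_comp mHL mx).
- exact: measurable_funD.
- by move=> w; have := HL0 (x, w); rewrite lee_fin.
move=> w; rewrite /truncated -mulrA mulrCA -mulrDr mulrC.
apply: ler_wpM2l; first exact: likelihood_ge0.
have := H1 x (symmetrize w) ux; have := H0 (x, symmetrize w).
rewrite indicE; case: (_ \in truncation_event d n l delta) => /=; lra.
Qed.

(** The case H = 1 of [integral_spiked_le], whose left side is then the total mass 1. *)
Lemma truncated_mass : (1 - err)%:E <= \int[X]_x \int[G]_w (K (x, w))%:E.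
Proof.
have := integral_spiked_le (cst 1%R) (measurable_cst _) (fun=> ler01) (fun _ _ _ => lexx _).
rewrite integral_cst_prob.
under [X in _ <= X + _ -> _]eq_integral do under eq_integral do rewrite mulr1.
by rewrite -leeBlDr// -EFinB.
Qed.

Lemma spiked_le_truncated (A : set (tensor R d n)) : measurable A ->
  (X \x W) (spike l @^-1` A) <=
  \int[X]_x \int[G]_w (K (x, w) * \1_A (symmetrize w))%:E + err%:E.
Proof.
move=> mA.
have mA1 : measurable_fun setT (fun p : rvec R n * tensor R d n => \1_A p.2 : R).
  have m : measurable_fun setT (\1_A : _ -> R) by exact: measurable_indic.
  by apply: (measurableT_comp m).
have mS : measurable (spike l @^-1` A).
  by have := @measurable_spike R d n l measurableT _ mA; rewrite setTI.
have -> : (X \x W) (spike l @^-1` A) = \int[X \x W]_p (\1_A (spike l p))%:E.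
  rewrite -[LHS]/((X \x W : probability (rvec R n * tensor R d n)%type R) _).
  have := integral_indic (X \x W : probability (rvec R n * tensor R d n)%type R) measurableT mS.
  rewrite setIT => <-; apply: eq_integral => p _.
  by rewrite !indicE.
have h1 (x : rvec R n) (T : tensor R d n) : unit_vec x -> (\1_A (x, T).2 <= 1 :> R)%R.
  by move=> _; rewrite indicE; case: (_ \in A).
have h0 (p : rvec R n * tensor R d n) : (0 <= \1_A p.2 :> R)%R by [].
exact: (integral_spiked_le (fun p => \1_A p.2) mA1 h0 h1).
Qed.

Local Notation c := (l ^+ 2 / 2)%R.

Definition small_bound (t0 v : R) : R :=
  (expR (n%:R * (c * v ^+ d)) * \1_(`]-oo, t0]) v)%R.

Definition large_bound (t0 v : R) : R :=
  (expR (n%:R * (c * tail_rate d v + l * delta)) * \1_(`]t0, 1%R]) v)%R.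

Lemma small_bound_ge0 t0 v : (0 <= small_bound t0 v)%R.
Proof. by rewrite mulr_ge0 ?expR_ge0. Qed.

Lemma large_bound_ge0 t0 v : (0 <= large_bound t0 v)%R.
Proof. by rewrite mulr_ge0 ?expR_ge0. Qed.

(* Without tilting ([a = 0]) the pair moment is [exp (n c <x,y>^d)]; the tilt *)
(* [a = l r / (1 + r)], [r = |<x,y>|^d], turns [r] into [r / (1 + r)]. *)
Lemma truncated_pair_le (t0 : R) (x y : rvec R n) :
  \int[G]_w (K (x, w) * K (y, w))%:E <=
  (small_bound t0 `|dotp x y| + large_bound t0 `|dotp x y|)%:E.
Proof.
have [uxy|nuxy] := pselect (unit_vec x /\ unit_vec y); last first.
  have -> : \int[G]_w (K (x, w) * K (y, w))%:E = 0; last first.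
    by rewrite lee_fin; apply: addr_ge0; [exact: small_bound_ge0|exact: large_bound_ge0].
  apply: integral0_eq => w _; rewrite /truncated !indicE.
  have [/set_mem[ux _]|_] := boolP ((x, w) \in truncation_event d n l delta); last by rewrite !mul0r.
  have [/set_mem[uy _]|_] := boolP ((y, w) \in truncation_event d n l delta); last by rewrite mul0r mulr0.
  by exfalso; apply: nuxy.
case: uxy => ux uy; have t1 := dotp_unit_le1 n x y ux uy.
set v := `|dotp x y|%R in t1 *.
have v0 : (0 <= v)%R by exact: normr_ge0.
have rv : (dotp x y ^+ d <= v ^+ d)%R by rewrite -normrX ler_norm.
have vd0 : (0 <= v ^+ d)%R by rewrite exprn_ge0.
have N0 : (0 <= n%:R / 2 :> R)%R by rewrite divr_ge0.
have [vt|tv] := leP v t0.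
  apply: (le_trans (truncated_pair d n n_gt0 l delta 0%R x y (lexx _))).
  rewrite lee_fin -[leLHS]addr0 lerD ?large_bound_ge0//.
  rewrite /small_bound indicE mem_set/= ?in_itv//= mulr1 ler_expR.
  have := ler_wpM2l (mulr_ge0 N0 (sqr_ge0 l)) rv; lra.
have rho0 : (0 < 1 + v ^+ d)%R by rewrite ltr_wpDr.
(* The minimizer of [(l - a)^2 (1 + v^d) + 2 a l], the exponent at delta = 0. *)
pose a := (l * v ^+ d / (1 + v ^+ d))%R.
have a0 : (0 <= a)%R by rewrite divr_ge0 ?mulr_ge0// ltW.
apply: (le_trans (truncated_pair d n n_gt0 l delta a x y a0)).
rewrite lee_fin -[leLHS]add0r lerD ?small_bound_ge0//.
rewrite /large_bound indicE mem_set/= ?in_itv/= ?tv ?t1// mulr1 ler_expR.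
have -> : (n%:R * (c * tail_rate d v + l * delta) =
    n%:R / 2 * (l ^+ 2 * tail_rate d v + 2 * l * delta))%R by field.
apply: ler_wpM2l => //.
have h1 : ((l - a) ^+ 2 * (1 + dotp x y ^+ d) <= (l - a) ^+ 2 * (1 + v ^+ d))%R.
  by apply: ler_wpM2l; rewrite ?sqr_ge0// lerD2l.
have h2 : (a * delta <= l * delta)%R.
  apply: ler_wpM2r => //; rewrite /a ler_pdivrMr// ler_wpM2l// lerDr//.
have h3 : ((l - a) ^+ 2 * (1 + v ^+ d) - l ^+ 2 + 2 * a * l = l ^+ 2 * tail_rate d v)%R.
  by rewrite /a /tail_rate; field; rewrite gt_eqF.
lra.
Qed.

Let mover : measurable_fun setT (fun p : rvec R n * rvec R n => `|dotp p.1 p.2|%R).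
Proof. by apply: measurableT_comp => //; exact: measurable_dotp. Qed.

Lemma measurable_small_bound t0 :
  measurable_fun setT (fun p : rvec R n * rvec R n => small_bound t0 `|dotp p.1 p.2|).
Proof.
apply: measurable_funM.
  apply: measurableT_comp => //; apply: measurable_funM => //; apply: measurable_funM => //.
  exact: measurable_funX.
have m : measurable_fun setT (\1_(`]-oo, t0]) : R -> R) by apply: measurable_indic.
exact: (measurableT_comp m mover).
Qed.

Lemma measurable_large_bound t0 :
  measurable_fun setT (fun p : rvec R n * rvec R n => large_bound t0 `|dotp p.1 p.2|).
Proof.
apply: measurable_funM.
  apply: measurableT_comp => //; apply: measurable_funM => //; apply: measurable_funD => //.
  apply: measurable_funM => //.
  by apply: (measurable_tail_rate (fun p : rvec R n * rvec R n => `|dotp p.1 p.2|%R)).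
have m : measurable_fun setT (\1_(`]t0, 1%R]) : R -> R) by apply: measurable_indic.
exact: (measurableT_comp m mover).
Qed.

(** The weight q is kept only on small overlaps, where its decay matters; on large ones q <= 1 is
    enough, since their contribution will be exponentially small. *)
Lemma pair_moment_le (I : finType) (phi : I -> rvec R n -> R) (t0 : R) (q : R -> R) :
  (forall i, measurable_fun setT (phi i)) -> measurable_fun setT q ->
  (forall x y, \sum_i phi i x * phi i y = q `|dotp x y|%R)%R ->
  (forall v, 0 <= q v)%R -> (forall v, (0 <= v <= 1)%R -> q v <= 1)%R ->
  pair_moment X G K I phi <=
  \int[X \x X]_p (q `|dotp p.1 p.2|%R * small_bound t0 `|dotp p.1 p.2|)%:E +
  \int[X \x X]_p (large_bound t0 `|dotp p.1 p.2|)%:E.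
Proof.
move=> mphi mq phiq q0 q1; have ms := measurable_small_bound t0.
have ml := measurable_large_bound t0.
have mqo : measurable_fun setT (fun p : rvec R n * rvec R n => q `|dotp p.1 p.2|%R).
  exact: (measurableT_comp mq).
rewrite -(ge0_integralD_EFin (X \x X : probability (rvec R n * rvec R n)%type R))//; first last.
- by move=> p; exact: large_bound_ge0.
- by move=> p; rewrite mulr_ge0// small_bound_ge0.
- exact: measurable_funM.
have mKK : measurable_fun setT (fun z : (rvec R n * rvec R n) * tensor R d n =>
   (K (z.1.1, z.2) * K (z.1.2, z.2))%R).
  by apply: measurable_funM; apply: (measurableT_comp mK);
    apply: measurable_fun_pair => //; apply: measurableT_comp.
rewrite /pair_moment.
under eq_integral do under eq_integral do rewrite phiq.
apply: (ge0_le_integral _ measurableT).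
- move=> p _; apply: integral_ge0 => w _.
  by rewrite lee_fin mulr_ge0// mulr_ge0// truncated_ge0.
- apply: (measurable_fun_fubini_tonelli_F (m2 := G)
    (fun z : (rvec R n * rvec R n) * tensor R d n =>
      (K (z.1.1, z.2) * K (z.1.2, z.2) * q `|dotp z.1.1 z.1.2|%R)%:E)).
    apply/measurable_EFinP; apply: measurable_funM => //.
    exact: (measurableT_comp mqo).
  by move=> z; rewrite lee_fin mulr_ge0// mulr_ge0// truncated_ge0.
- by apply/measurable_EFinP; apply: measurable_funD => //; exact: measurable_funM.
move=> [x y] _ /=.
under eq_integral do rewrite mulrC.
have mxy : measurable_fun setT (fun w : tensor R d n => ((x, y), w)) by exact: measurable_fun_pair.
have mKxy := measurableT_comp mKK mxy.
have Kxy0 w : (0 <= K (x, w) * K (y, w))%R by rewrite mulr_ge0// truncated_ge0.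
rewrite (ge0_integralZl_real G _ _ mKxy Kxy0)//.
have q0' : 0 <= (q `|dotp x y|%R)%:E by rewrite lee_fin.
apply: (le_trans (lee_wpmul2l q0' (truncated_pair_le t0 x y))).
rewrite -EFinM lee_fin mulrDr lerD2l /large_bound indicE.
have [/set_mem/=|_] := boolP (`|dotp x y|%R \in _); last by rewrite !mulr0.
by rewrite in_itv/= => /andP[_ v1]; rewrite -[leRHS]mul1r ler_wpM2r ?q1 ?normr_ge0.
Qed.

End spiked_model.

Section spiked_inequalities.
Context {R : realType}.
Variables (d n : nat) (n_gt0 : (0 < n)%N) (l delta : R).
Hypotheses (l0 : 0 <= l) (delta0 : 0 <= delta).
Variable X : probability (rvec R n) R.
Hypothesis hX : X [set x | unit_vec x] = 1%E.
Local Notation G := (iid (normal_prob (0 : R) (Num.sqrt (2 / n%:R) : R))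
                         #|{: {ffun 'I_d -> 'I_n}}|).
Local Notation W := (wigner_tensor R d n).
Local Notation K := (truncated d n l delta).
Local Notation err := (expR (- (n%:R * delta ^+ 2 / 4))).
Local Open Scope ereal_scope.

Let KB p := truncated_bound d n n_gt0 l delta p l0.

Let integral_sym_indic (A : set (tensor R d n)) :
  \int[X]_x \int[G]_w (K (x, w) * \1_A (symmetrize w))%:E =
  \int[X]_x \int[G]_w (K (x, w) * \1_(@symmetrize R d n @^-1` A) w)%:E.
Proof. by apply: eq_integral => x _; apply: eq_integral => w _; rewrite !indicE. Qed.

Let measurable_sym_preimage (A : set (tensor R d n)) :
  measurable A -> measurable (@symmetrize R d n @^-1` A).
Proof. by move=> mA; have := @measurable_symmetrize R d n measurableT _ mA; rewrite setTI. Qed.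

Lemma spiked_le_sqr (A : set (tensor R d n)) (theta : R) : measurable A -> (0 < theta)%R ->
  (X \x W) (spike l @^-1` A) <=
  (theta / 2)%:E * second_moment X G K + ((2 * theta)^-1)%:E * W A + err%:E.
Proof.
move=> mA th; apply: (le_trans (spiked_le_truncated d n n_gt0 l delta delta0 X hX A mA)).
apply: leeD2r; rewrite integral_sym_indic.
exact: (truncated_contiguity X G K _ (measurable_truncated d n l delta)
  (truncated_ge0 d n l delta) KB _ theta (measurable_sym_preimage A mA) th).
Qed.

Lemma spiked_le_wigner (A : set (tensor R d n)) (theta m : R) : measurable A ->
  (0 < theta)%R -> second_moment X G K <= m%:E ->
  (X \x W) (spike l @^-1` A) <=
  W A + (theta / 2 + (m - 1 + 2 * err) / (2 * theta) + err)%:E.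
Proof.
move=> mA th hm; apply: (le_trans (spiked_le_truncated d n n_gt0 l delta delta0 X hX A mA)).
rewrite EFinD addeA; apply: leeD2r; rewrite integral_sym_indic.
exact: (truncated_total_variation X G K _ (measurable_truncated d n l delta)
  (truncated_ge0 d n l delta) KB _ theta m err (measurable_sym_preimage A mA) th hm
  (truncated_mass d n n_gt0 l delta delta0 X hX)).
Qed.

Let I := ('I_n * 'I_n)%type.
(** Entries of [x^{(x) 2}]: squaring forgets the sign of the spike and makes the kernel [<x,y>^2]
    nonnegative. *)
Let phi (i : I) (x : rvec R n) : R := (tnth x i.1 * tnth x i.2)%R.

Let sum_phi (x y : rvec R n) : (\sum_i phi i x * phi i y = dotp x y ^+ 2)%R.
Proof.
rewrite expr2 /dotp big_distrlr/= pair_bigA/=.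
by apply: eq_bigr => i _; rewrite /phi; ring.
Qed.

Let mphi i : measurable_fun setT (phi i).
Proof. by apply: measurable_funM; exact: measurable_tnth. Qed.

Definition overlap_moment := pair_moment X G K I phi.

Lemma second_moment_le (t0 : R) :
  second_moment X G K <= \int[X \x X]_p (small_bound d n l t0 `|dotp p.1 p.2|)%:E +
    \int[X \x X]_p (large_bound d n l delta t0 `|dotp p.1 p.2|)%:E.
Proof.
have := pair_moment_le d n n_gt0 l delta l0 delta0 X unit (fun=> cst 1%R) t0 (cst 1%R).
under [X in _ -> _ -> _ -> _ -> _ -> _ <= X + _]eq_integral do rewrite mul1r.
apply => //.
by move=> x y; rewrite (big_pred1 tt) ?mulr1//; case.
Qed.

Lemma overlap_moment_le (t0 : R) :
  overlap_moment <=
    \int[X \x X]_p (`|dotp p.1 p.2| ^+ 2 * small_bound d n l t0 `|dotp p.1 p.2|)%:E +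
    \int[X \x X]_p (large_bound d n l delta t0 `|dotp p.1 p.2|)%:E.
Proof.
apply: (pair_moment_le d n n_gt0 l delta l0 delta0 X I phi t0 (fun v => v ^+ 2)%R).
- exact: mphi.
- exact: measurable_funX.
- by move=> x y; rewrite sum_phi real_normK// num_real.
- by move=> v; rewrite sqr_ge0.
- by move=> v /andP[v0 v1]; rewrite expr_le1.
Qed.

Let psi (xhat : tensor R d n -> rvec R n) (i : I) (w : tensor R d n) : R :=
  phi i (xhat (symmetrize w)).

Let truncated_phi_bound (p : rvec R n * tensor R d n) i :
  (`|K p * phi i p.1| <= expR (n%:R / 2 * (l * (l + delta))))%R.
Proof.
rewrite {1}/truncated indicE; have [/set_mem hg|_] := boolP (p \in truncation_event d n l delta); last first.
  by rewrite !mul0r normr0 expR_ge0.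
have [u _] := hg.
have coord j : (`|tnth p.1 j| <= 1)%R.
  rewrite -(expr_le1 (ltn0Sn 1))// real_normK ?num_real// -[leRHS]u /dotp (bigD1 j)//= expr2.
  by rewrite lerDl sumr_ge0// => k _; rewrite -expr2 sqr_ge0.
rewrite normrM -[leRHS]mulr1; apply: ler_pM => //.
  rewrite mul1r ger0_norm ?likelihood_ge0//.
  by have := KB p; rewrite /truncated indicE mem_set ?mul1r.
by rewrite /phi normrM mulr_ile1.
Qed.

Lemma overlap_sqr_le (xhat : tensor R d n -> rvec R n) (theta : R) :
  measurable_fun setT xhat -> (forall T, unit_vec (xhat T)) -> (0 < theta)%R ->
  \int[X \x W]_p (dotp p.1 (xhat (spike l p)) ^+ 2)%:E <=
  (theta / 2)%:E + ((2 * theta)^-1)%:E * overlap_moment + err%:E.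
Proof.
move=> mx ux th.
pose H (p : rvec R n * tensor R d n) : R := (dotp p.1 (xhat p.2) ^+ 2)%R.
have mH : measurable_fun setT H.
  apply: measurable_funX; apply: measurable_dotp => //.
  exact: (measurableT_comp mx).
have H0 p : (0 <= H p)%R by rewrite sqr_ge0.
have H1 x T : unit_vec x -> (H (x, T) <= 1)%R.
  move=> ux'; rewrite /H -real_normK ?num_real// expr_le1//.
  exact: dotp_unit_le1.
apply: (le_trans (integral_spiked_le d n n_gt0 l delta delta0 X hX H mH H0 H1)).
apply: leeD2r.
under eq_integral do under eq_integral do rewrite /H/= -sum_phi.
apply: (truncated_recovery X G K (measurable_truncated d n l delta)
  (truncated_ge0 d n l delta) I phi (psi xhat) _ theta mphi _ truncated_phi_bound) => //.
- move=> i; apply: (measurableT_comp (mphi i)); apply: (measurableT_comp mx).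
  exact: measurable_symmetrize.
- by move=> x y; rewrite sum_phi sqr_ge0.
- by move=> x w; rewrite /psi sum_phi sqr_ge0.
- move=> w; have := sum_phi (xhat (symmetrize w)) (xhat (symmetrize w)).
  by rewrite ux expr1n => <-; apply: eq_bigr => i _; rewrite expr2.
Qed.

(** Passes from the squared overlap to its absolute value by [|z| <= tau/2 + z^2/(2 tau)]. *)
Lemma expected_correlation_le (xhat : tensor R d n -> rvec R n) (tau theta : R) :
  measurable_fun setT xhat -> (forall T, unit_vec (xhat T)) ->
  (0 < tau)%R -> (0 < theta)%R ->
  \int[X \x W]_p `|dotp p.1 (xhat (spike l p))|%:E <=
  (tau / 2)%:E + ((2 * tau)^-1)%:E *
    ((theta / 2)%:E + ((2 * theta)^-1)%:E * overlap_moment + err%:E).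
Proof.
move=> mx ux tau0 th.
have md : measurable_fun setT (fun p : rvec R n * tensor R d n => dotp p.1 (xhat (spike l p))).
  apply: measurable_dotp => //; apply: (measurableT_comp mx); exact: measurable_spike.
have tau2 : (0 <= (2 * tau)^-1)%R by rewrite invr_ge0 mulr_ge0// ltW.
pose XW : probability (rvec R n * tensor R d n)%type R := X \x W.
apply: (@le_trans _ _ (\int[XW]_p (tau / 2 + (2 * tau)^-1 * dotp p.1 (xhat (spike l p)) ^+ 2)%:E)).
  apply: (ge0_le_integral_EFin XW).
  - exact: measurableT_comp.
  - apply: measurable_funD => //; apply: measurable_funM => //; exact: measurable_funX.
  - by move=> p; rewrite normr_ge0.
  move=> p; set z := dotp _ _; rewrite -subr_ge0 -(real_normK (num_real z)).
  have -> : (tau / 2 + (2 * tau)^-1 * `|z| ^+ 2 - `|z| = (tau - `|z|) ^+ 2 / (2 * tau))%R.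
    by field; rewrite gt_eqF.
  by rewrite divr_ge0 ?sqr_ge0// mulr_ge0// ltW.
have md2 : measurable_fun setT (fun p : rvec R n * tensor R d n =>
  dotp p.1 (xhat (spike l p)) ^+ 2)%R by exact: measurable_funX.
rewrite (ge0_integralD_EFin XW); first last.
- by move=> p; rewrite mulr_ge0// sqr_ge0.
- by move=> p; rewrite divr_ge0// ltW.
- exact: measurable_funM.
- exact: measurable_cst.
rewrite integral_cst_prob (ge0_integralZl_real XW)//; last by move=> p; rewrite sqr_ge0.
apply: leeD2l; apply: lee_wpmul2l; first by rewrite lee_fin.
exact: overlap_sqr_le.
Qed.

End spiked_inequalities.

(** * Asymptotics *)

Section asymptotics.
Context {R : realType}.

Lemma near_divn_le (c eps : R) : 0 < eps -> \forall n \near \oo, c / n%:R <= eps.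
Proof.
move=> e0; exists (Num.truncn (`|c| / eps)).+1 => // n /= Nn.
have n0 : 0 < n%:R :> R by rewrite ltr0n (leq_trans _ Nn).
rewrite ler_pdivrMr//; apply: (le_trans (ler_norm c)).
rewrite mulrC -ler_pdivrMr// ltW//.
have ce0 : 0 <= `|c| / eps by rewrite divr_ge0// ltW.
have /andP[_ h] := truncn_itv ce0.
by apply: (lt_le_trans h); rewrite ler_nat.
Qed.

Lemma expRN_le_inv (x : R) : 0 < x -> expR (- x) <= x^-1.
Proof.
move=> x0; rewrite expRN lef_pV2 ?posrE ?expR_gt0//.
by have := expR_ge1Dx x; lra.
Qed.

Lemma near_expRN_le (gamma c eps : R) : 0 < gamma -> 0 <= c -> 0 < eps ->
  \forall n \near \oo, c * expR (- (n%:R * gamma)) <= eps.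
Proof.
move=> g0 c0 e0; near=> n.
have n0 : 0 < n%:R :> R by rewrite ltr0n; near: n; exact: nbhs_infty_gt.
apply: (@le_trans _ _ (c / gamma / n%:R)).
  rewrite -mulrA ler_wpM2l// -invfM mulrC.
  by rewrite expRN_le_inv// mulr_gt0.
near: n; exact: near_divn_le.
Unshelve. all: by end_near. Qed.

Lemma uniform_near (b : nat -> R -> R) (f : R -> R) (A : set R) (eps : R) :
  {uniform A, b @ \oo --> f} -> 0 < eps ->
  \forall n \near \oo, forall t, A t -> `|f t - b n t| < eps.
Proof.
move=> bf e0.
have := bf [set h | forall t, A t -> `|f t - h t| < eps]; apply.
apply/uniform_nbhs; exists [set xy : R * R | `|xy.1 - xy.2| < eps]; split; last by [].
exact: entourage_ball (PosNum e0).
Qed.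

Lemma overlap_rate_le (X : prior R) (n : nat) (t b : R) : (0 < n)%N ->
  (b%:E <= overlap_rate X n t)%E ->
  (overlap_prob X n [set r | (t <= r)%R] <= (expR (- (n%:R * b)))%:E)%E.
Proof.
rewrite /overlap_rate => n0; set p := overlap_prob _ _ _.
have p0 : (0 <= p)%E by exact: measure_ge0.
have p1 : (p <= 1)%E.
  rewrite /p /overlap_prob; apply: probability_le1.
  have m := measurable_dotp n _ _ (@measurable_fst _ _ (rvec R n) (rvec R n))
     (@measurable_snd _ _ (rvec R n) (rvec R n)).
  have := m measurableT _ (measurable_itv `[t, +oo[); rewrite setTI.
  by rewrite (_ : _ @^-1` _ = [set q | t <= dotp q.1 q.2])//; apply/seteqP; split => q /=;
    rewrite in_itv/= andbT.
case: p p0 p1 => [p| |]//; rewrite !lee_fin => p0 _.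
(* Probability 0 has rate +oo, where the logarithm cannot be inverted in R. *)
have [->|pn0] := eqVneq p 0; first by rewrite expR_ge0.
have {}p0 : 0 < p by rewrite lt_neqAle eq_sym pn0.
rewrite lne_EFin// -EFinM -EFinN lee_fin => h.
rewrite -[leLHS](lnK p0) ler_expR lerNr mulrC -ler_pdivlMr ?ltr0n//.
by rewrite mulNr mulrC.
Qed.

End asymptotics.

(** * Overlap tails of the prior *)

Section prior_tails.
Context {R : realType}.
Variable X : prior R.
Hypothesis hsym : symmetric_overlap X.
Local Open Scope ereal_scope.

(** By symmetry both one-sided tails have the same probability. *)
Lemma abs_overlap_tail (n : nat) (r : R) : (0 < n)%N ->
  (X n \x X n) [set p | r <= `|dotp p.1 p.2|]%R <=
  2%:E * overlap_prob X n [set t | (r <= t)%R].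
Proof.
move=> n0.
have m := measurable_dotp n _ _ (@measurable_fst _ _ (rvec R n) (rvec R n))
     (@measurable_snd _ _ (rvec R n) (rvec R n)).
have m1 : measurable [set p : rvec R n * rvec R n | r <= dotp p.1 p.2]%R.
  have := m measurableT _ (measurable_itv `[r, +oo[); rewrite setTI.
  by rewrite (_ : _ @^-1` _ = [set q | r <= dotp q.1 q.2]%R)//; apply/seteqP; split => q /=;
    rewrite in_itv/= andbT.
have m2 : measurable [set p : rvec R n * rvec R n | r <= - dotp p.1 p.2]%R.
  have := m measurableT _ (measurable_itv `]-oo, (- r)%R]); rewrite setTI.
  by rewrite (_ : _ @^-1` _ = [set q | r <= - dotp q.1 q.2]%R)//; apply/seteqP; split => q /=;
    rewrite in_itv/= lerNr.
have E : overlap_prob X n [set t | (r <= t)%R] = (X n \x X n) [set p | r <= - dotp p.1 p.2]%R.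
  rewrite hsym//; have := measurable_itv `[r, +oo[.
  by rewrite set_itvE.
have -> : 2%:E * overlap_prob X n [set t | (r <= t)%R] =
    (X n \x X n) [set p | r <= dotp p.1 p.2]%R + (X n \x X n) [set p | r <= - dotp p.1 p.2]%R.
  by rewrite -E -mule2n mule_natl.
pose XX : probability (rvec R n * rvec R n)%type R := X n \x X n.
apply: (le_trans _ (measureU2 XX m1 m2)); apply: (le_measure XX); rewrite ?inE//.
- rewrite (_ : [set p | _] = [set p : rvec R n * rvec R n | r <= dotp p.1 p.2]%R `|`
     [set p | r <= - dotp p.1 p.2]%R); first exact: measurableU.
  by apply/seteqP; split => p /=; rewrite ler_normr => /orP.
- exact: measurableU.
- by move=> p /=; rewrite ler_normr => /orP.
Qed.

Lemma subgaussian_tail (v eta : R) : locally_subgaussian X v -> (0 < eta)%R ->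
  exists t1 C : R, [/\ (0 < t1)%R, (0 < C)%R & forall n, (0 < n)%N ->
    forall r, (0 <= r <= t1)%R ->
    (X n \x X n) [set p | r <= `|dotp p.1 p.2|]%R <=
    (C * expR (- (n%:R * (2 * v + eta)^-1 * r ^+ 2)))%:E].
Proof.
move=> hs e0; have [t1 [C [t10 C0 hC]]] := hs eta e0.
exists t1, (2 * C)%R; split; rewrite ?mulr_gt0// => n n0 r hr.
apply: (le_trans (abs_overlap_tail n r n0)).
rewrite -mulrA EFinM; apply: lee_wpmul2l => //; apply: (le_trans (hC n n0 r hr)).
by rewrite lee_fin le_eqVlt; apply/orP; left; apply/eqP; congr (_ * expR _)%R; ring.
Qed.

(** Uniform convergence gives one threshold in n for all r. The loss eps in the exponent is
    affordable only for r away from 0. *)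
Lemma rate_tail (d : nat) (ls : R) (f : R -> R) (eps : R) : rate_function X f ->
  (forall t, 0 <= t < 1 -> ls ^+ 2 / 2 * (t ^+ d / (1 + t ^+ d)) <= f t)%R -> (0 < eps)%R ->
  \forall n \near \oo, forall r, (0 <= r < 1)%R ->
    (X n \x X n) [set p | r <= `|dotp p.1 p.2|]%R <=
    (2 * expR (- (n%:R * (ls ^+ 2 / 2 * tail_rate d r - eps))))%:E.
Proof.
move=> [b [hb bf]] hf e0; near=> n => r hr.
have n0 : (0 < n)%N by near: n; exact: nbhs_infty_gt.
have ub : forall t, `[0%R, 1%R[%classic t -> (`|f t - b n t| < eps)%R.
  by near: n; exact: uniform_near.
apply: (le_trans (abs_overlap_tail n r n0)).
rewrite EFinM; apply: lee_wpmul2l => //.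
apply: (le_trans (overlap_rate_le _ _ _ _ n0 (hb n n0 r hr))).
rewrite lee_fin ler_expR lerN2 ler_wpM2l//.
have := hf r hr; have := ub r; rewrite /= in_itv/= => /(_ hr); rewrite ltr_norml /tail_rate.
by move=> /andP[h1 h2]; lra.
Unshelve. all: by end_near. Qed.

End prior_tails.

Section asymptotic_moments.
Context {R : realType}.
Variables (d : nat) (X : prior R).
Hypothesis hsym : symmetric_overlap X.
Variables (ls : R) (f : R -> R).
Hypothesis hf : rate_function X f.
Hypothesis hfd : forall t : R, 0 <= t < 1 ->
  ls ^+ 2 / 2 * (t ^+ d / (1 + t ^+ d)) <= f t.
Variables (sigma : R) (hsub : locally_subgaussian X (sigma ^+ 2)).
Variable l : R.
Hypotheses (l0 : 0 <= l) (lls : l < ls).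
Local Notation G n := (iid (normal_prob (0 : R) (Num.sqrt (2 / n%:R) : R))
                         #|{: {ffun 'I_d -> 'I_n}}|).

Let XX n : probability (rvec R n * rvec R n)%type R := (X n \x X n)%E.

Let mover n : measurable_fun setT (fun p : rvec R n * rvec R n => `|dotp p.1 p.2|).
Proof. by apply: measurableT_comp => //; exact: measurable_dotp. Qed.

Let over0 n (p : rvec R n * rvec R n) : 0 <= `|dotp p.1 p.2|. Proof. exact: normr_ge0. Qed.

Lemma large_moment_vanishes (t0 : R) : 0 < t0 -> t0 <= 1 ->
  exists2 delta : R, 0 < delta & forall eps, 0 < eps -> \forall n \near \oo,
    (\int[X n \x X n]_p (large_bound d n l delta t0 `|dotp p.1 p.2|)%:E <= eps%:E)%E.
Proof.
move=> t00 t01; pose c := l ^+ 2 / 2; pose cs := ls ^+ 2 / 2.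
have ls0 : 0 < ls by exact: le_lt_trans lls.
have c0 : 0 <= c by rewrite divr_ge0// sqr_ge0.
have ccs : c < cs by rewrite ltr_pM2r ?invr_gt0// ltrXn2r.
have g0 := tail_rate_gt0 d t0 t00.
(* The gap between tail and growth at [t0] is split into four: truncation slack [l * delta], rate
   error, grid error, and the remaining decay rate. The denominator l + 1 in [delta] allows l =
   0. *)
pose gamma := (cs - c) * tail_rate d t0 / 4.
have gamma0 : 0 < gamma by rewrite divr_gt0// mulr_gt0// subr_gt0.
pose delta := gamma / (l + 1).
have l1 : 0 < l + 1 by rewrite ltr_wpDl.
have ld : l * delta <= gamma.
  by rewrite /delta mulrA ler_pdivrMr// mulrC ler_wpM2l ?(ltW gamma0)// lerDl.
have cs0 : 0 <= cs by exact: le_trans c0 (ltW ccs).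
have csd : 0 <= cs * d%:R / gamma by rewrite divr_ge0 ?(ltW gamma0)// mulr_ge0.
pose N := (Num.truncn (cs * d%:R / gamma)).+1.
have hN : cs * d%:R / N%:R <= gamma.
  rewrite ler_pdivrMr ?ltr0n// [leRHS]mulrC -ler_pdivrMr//.
  by have /andP[_ /ltW] := truncn_itv csd.
exists delta; first by rewrite divr_gt0.
move=> eps e0; near=> n.
have tail : forall r, (0 <= r < 1)%R ->
    ((X n \x X n) [set p | r <= `|dotp p.1 p.2|]%R <=
    (2 * expR (- (n%:R * (cs * tail_rate d r - gamma))))%:E)%E.
  by near: n; exact: (rate_tail X hsym d ls f gamma hf hfd gamma0).
apply: (le_trans (large_overlap_moment (XX n) _ (mover n) (over0 n)
  n N d c cs (l * delta) gamma gamma t0 (ltn0Sn _) c0 ccs t00 t01 _ tail)).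
  have : gamma * 4 = (cs - c) * tail_rate d t0 by rewrite /gamma divfK.
  by lra.
rewrite lee_fin mulrA; near: n; exact: near_expRN_le.
Unshelve. all: by end_near. Qed.

Lemma second_moment_bounded : d = 2%N -> l * sigma < 1 -> 0 < sigma ->
  exists delta m : R, 0 < delta /\
    \forall n \near \oo, (second_moment (X n) (G n) (truncated d n l delta) <= m%:E)%E.
Proof.
move=> d2 ls1 s0.
pose num := 2 - 2 * (l * sigma) ^+ 2.
have num0 : 0 < num.
  by rewrite subr_gt0 -[ltRHS]mulr1 ltr_pM2l// expr_lt1// mulr_ge0// ltW.
have l21 : 0 < l ^+ 2 + 1 by rewrite ltr_wpDl// sqr_ge0.
(* The aim [c < kappa] reads [l^2 eta < num]. *)
pose eta := num / (l ^+ 2 + 1).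
have eta0 : 0 < eta by rewrite divr_gt0.
have [t1 [C [t10 C0 tail]]] := subgaussian_tail X hsym _ eta hsub eta0.
pose kappa := (2 * sigma ^+ 2 + eta)^-1.
have k0 : 0 < 2 * sigma ^+ 2 + eta by rewrite addr_gt0// mulr_gt0// exprn_gt0.
pose c := l ^+ 2 / 2.
have ck : c < kappa.
  rewrite /kappa -[ltRHS]mul1r ltr_pdivlMr// /c.
  have : eta * (l ^+ 2 + 1) = num by rewrite /eta divfK// gt_eqF.
  rewrite /num exprMn => E; have : 0 < eta by [].
  lra.
pose t0 := Num.min t1 1.
have t00 : 0 < t0 by rewrite lt_min t10/=.
have t01 : t0 <= 1 by rewrite ge_min lexx orbT.
have t0t1 : t0 <= t1 by rewrite ge_min lexx.
have [delta delta0 large] := large_moment_vanishes t0 t00 t01.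
exists delta, (C * expR c / (1 - expR (c - kappa)) + 1); split => //.
near=> n.
have n0 : (0 < n)%N by near: n; exact: nbhs_infty_gt.
apply: (le_trans (second_moment_le d n n0 l delta l0 (ltW delta0) (X n) t0)).
rewrite EFinD; apply: leeD; last by near: n; exact: large.
have tl r : 0 <= r <= t0 -> ((X n \x X n) [set p | r <= `|dotp p.1 p.2|]%R <=
    (C * expR (- (n%:R * kappa * r ^+ 2)))%:E)%E.
  by move=> /andP[r0 rt]; apply: tail => //; rewrite r0 (le_trans rt).
have c0 : 0 <= c by rewrite divr_ge0// sqr_ge0.
apply: (le_trans _ (small_overlap_moment (XX n) _ (mover n) (over0 n)
  n kappa c C t0 n0 c0 ck (ltW C0) t00 t01 tl)).
rewrite le_eqVlt; apply/orP; left; apply/eqP.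
by apply: eq_integral => p _; rewrite /small_bound d2; congr (expR _ * _)%:E; rewrite mulrA.
Unshelve. all: by end_near. Qed.

Lemma cubic_moments_vanish : (3 <= d)%N -> exists2 delta : R, 0 < delta &
  forall eps, 0 < eps -> \forall n \near \oo,
    (second_moment (X n) (G n) (truncated d n l delta) <= (1 + eps)%:E)%E /\
    (overlap_moment d n l delta (X n) <= eps%:E)%E.
Proof.
move=> d3.
have [t1 [C [t10 C0 tail]]] := subgaussian_tail X hsym _ 1 hsub ltr01.
pose kappa := (2 * sigma ^+ 2 + 1)^-1.
have k0 : 0 < kappa by rewrite invr_gt0 ltr_wpDl// mulr_ge0// sqr_ge0.
pose c := l ^+ 2 / 2; have c0 : 0 <= c by rewrite divr_ge0// sqr_ge0.
have c1 : 0 < c + 1 by rewrite ltr_wpDl.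
pose a := kappa / 4; have a0 : 0 < a by rewrite divr_gt0.
(* Ensures [c * t0 <= kappa / 4], so [a + c * t0] is at most half of kappa. *)
pose t2 := kappa / (4 * (c + 1)).
have t20 : 0 < t2 by rewrite divr_gt0// mulr_gt0.
pose t0 := Num.min t1 (Num.min 1 t2).
have t00 : 0 < t0 by rewrite !lt_min t10 t20/= ltr01.
have t01 : t0 <= 1 by rewrite !ge_min lexx !orbT.
have t0t1 : t0 <= t1 by rewrite ge_min lexx.
have t0t2 : t0 <= t2 by rewrite !ge_min lexx !orbT.
have ak : a + c * t0 < kappa.
  have h : c * t0 <= c * t2 by rewrite ler_wpM2l.
  have h2 : (c + 1) * t2 = kappa / 4 by rewrite /t2; field; rewrite gt_eqF.
  by rewrite /a; lra.
have [delta delta0 large] := large_moment_vanishes t0 t00 t01.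
pose K := C * expR (a + c * t0) / (1 - expR (a + c * t0 - kappa)).
have K0 : 0 <= K.
  rewrite divr_ge0 ?mulr_ge0 ?expR_ge0 ?(ltW C0)// subr_ge0 -expR0 ler_expR.
  by rewrite subr_le0 ltW.
exists delta => // eps e0.
have cK1 : 0 < c * K + 1 by rewrite ltr_wpDl// mulr_ge0.
(* Makes the first term of [small_overlap_cubic] at most eps/4; the second then vanishes as n
   grows. *)
pose theta := eps * a / (2 * (c * K + 1)).
have th0 : 0 < theta by rewrite divr_gt0 ?mulr_gt0.
have thE : c * theta / (2 * a) * K <= eps / 4.
  rewrite (_ : _ * K = eps / 4 * (c * K / (c * K + 1))); last first.
    by rewrite /theta; field; rewrite !gt_eqF.
  rewrite -[leRHS]mulr1 ler_wpM2l ?divr_ge0 ?(ltW e0)//.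
  by rewrite ler_pdivrMr// mul1r lerDl.
have e2 : 0 < eps / 2 by rewrite divr_gt0.
have e4 : 0 < eps / 4 by rewrite divr_gt0.
near=> n.
have n0 : (0 < n)%N by near: n; exact: nbhs_infty_gt.
have N0 : 0 < n%:R :> R by rewrite ltr0n.
have tl r : 0 <= r <= t0 -> ((X n \x X n) [set p | r <= `|dotp p.1 p.2|]%R <=
    (C * expR (- (n%:R * kappa * r ^+ 2)))%:E)%E.
  by move=> /andP[r0 rt]; apply: tail => //; rewrite r0 (le_trans rt).
have hl : (\int[X n \x X n]_p (large_bound d n l delta t0 `|dotp p.1 p.2|)%:E <= (eps / 2)%:E)%E.
  by near: n; exact: large.
split.
  apply: (le_trans (second_moment_le d n n0 l delta l0 (ltW delta0) (X n) t0)).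
  apply: (le_trans (leeD (small_overlap_cubic (XX n) _ (mover n) (over0 n)
    n d c a kappa C t0 n0 d3 c0 a0 ak (ltW C0) t00 t01 tl theta th0) hl)).
  rewrite -EFinD lee_fin -/K mulrDl.
  have : c / (theta * a ^+ 2 * n%:R) * K <= eps / 4.
    rewrite (_ : _ * K = c * K / (theta * a ^+ 2) / n%:R); last first.
      by field; rewrite !gt_eqF.
    by near: n; exact: near_divn_le.
  by lra.
apply: (le_trans (overlap_moment_le d n n0 l delta l0 (ltW delta0) (X n) t0)).
apply: (le_trans (leeD (small_overlap_square (XX n) _ (mover n) (over0 n)
    n d c a kappa C t0 n0 d3 c0 a0 ak (ltW C0) t00 t01 tl) hl)).
rewrite -EFinD lee_fin -/K.
have : (a * n%:R)^-1 * K <= eps / 2.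
  rewrite (_ : _ * K = K / a / n%:R); last by field; rewrite !gt_eqF.
  by near: n; exact: near_divn_le.
lra.
Unshelve. all: by end_near. Qed.

End asymptotic_moments.

(** * Null sequences and hypothesis tests *)

Section ereal_null_sequences.
Context {R : realType}.

Lemma cvge0_le (f : nat -> \bar R) : (forall n, 0 <= f n)%E ->
  (forall eps : R, 0 < eps -> \forall n \near \oo, (f n <= eps%:E)%E) ->
  (f n @[n --> \oo] --> 0)%E.
Proof.
move=> f0 fe; apply/fine_cvgP; split.
  apply: filterS (fe 1 ltr01) => n h.
  by rewrite ge0_fin_numE// (le_lt_trans h)// ltry.
apply/cvgrPdist_le => eps e0; apply: filterS (fe eps e0) => n h.
rewrite sub0r normrN ger0_norm; last exact: fine_ge0.
by rewrite -lee_fin fineK// ge0_fin_numE// (le_lt_trans h)// ltry.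
Qed.

Lemma cvge_near_dist (f : nat -> \bar R) (a eps : R) : (f n @[n --> \oo] --> a%:E)%E ->
  0 < eps -> \forall n \near \oo, ((a - eps)%:E <= f n <= (a + eps)%:E)%E.
Proof.
move=> /fine_cvgP[ffin /cvgrPdist_le fa] e0.
apply: filterS2 ffin (fa eps e0) => n fn.
rewrite -[f n]fineK// !lee_fin ler_norml /= => /andP[h1 h2].
by apply/andP; split; lra.
Qed.

End ereal_null_sequences.

Section testing.
Context {dd : measure_display} {T : nat -> measurableType dd} {R : realType}.
Variables P Q : forall n, probability (T n) R.

Lemma success_probE n (A : set (T n)) : measurable A ->
  success_prob (P n) (Q n) A = ((fine (P n A) + 1 - fine (Q n A)) / 2)%:E.
Proof.
move=> mA; rewrite /success_prob probability_setC//.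
rewrite -[P n A]fineK ?fin_num_measure// -[Q n A]fineK ?fin_num_measure//.
by rewrite -EFinB -!EFinM -EFinD; congr EFin; rewrite /=; field.
Qed.

(** Success tending to 1 forces Q(A) to 0, hence P(A) to 0 by contiguity; but P(A) <= 1/4 caps the
    success at 5/8. *)
Lemma contiguous_no_strong_detection : contiguous P Q -> ~ strong_detection P Q.
Proof.
move=> cPQ [A [mA suc]].
have Pfin n : P n (A n) \is a fin_num by apply: fin_num_measure; exact: mA.
have Qfin n : Q n (A n) \is a fin_num by apply: fin_num_measure; exact: mA.
have near_suc (eps : R) : 0 < eps -> \forall n \near \oo,
    1 - eps <= (fine (P n (A n)) + 1 - fine (Q n (A n))) / 2.
  move=> e0; apply: filterS (cvge_near_dist _ 1 eps suc e0) => n.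
  by rewrite success_probE// !lee_fin => /andP[].
have P1 n : fine (P n (A n)) <= 1.
  by rewrite -lee_fin fineK//; apply: probability_le1; exact: mA.
have Q0 n : 0 <= fine (Q n (A n)) by exact: fine_ge0.
have PA : (P n (A n) @[n --> \oo] --> 0)%E.
  apply: cPQ => //; apply: cvge0_le => // eps e0.
  have e2 : 0 < eps / 2 by rewrite divr_gt0.
  apply: filterS (near_suc _ e2) => n h.
  rewrite -[Q n (A n)]fineK// lee_fin.
  by have := P1 n; lra.
have e4 : 0 < 4^-1 :> R by rewrite invr_gt0.
have [n [h1 /andP[_ h2]]] := filter_ex (filterI (near_suc _ e4) (cvge_near_dist _ 0 _ PA e4)).
move: h2; rewrite -[P n (A n)]fineK// lee_fin => h2.
by have := Q0 n; lra.
Qed.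

(** A test succeeds with probability [1/2 + (P(A) - Q(A))/2]. *)
Lemma total_variation_no_weak_detection :
  (total_variation_dist (P n) (Q n) @[n --> \oo] --> 0)%E -> ~ weak_detection P Q.
Proof.
move=> tv [A [mA [eps e0 suc]]].
have Pfin n : P n (A n) \is a fin_num by apply: fin_num_measure; exact: mA.
have Qfin n : Q n (A n) \is a fin_num by apply: fin_num_measure; exact: mA.
have [n [h1 /andP[_ h2]]] := filter_ex (filterI suc (cvge_near_dist _ 0 _ tv e0)).
have h3 : (`|P n (A n) - Q n (A n)| <= (0 + eps)%:E)%E.
  by apply: (le_trans _ h2); apply: ereal_sup_ubound; exists (A n) => //; exact: mA.
move: h3 h1; rewrite success_probE// lee_fin.
rewrite -[P n (A n)]fineK// -[Q n (A n)]fineK//.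
rewrite -EFinB /= lee_fin ler_norml => /andP[_ h3] h1.
by lra.
Qed.

End testing.

(** * From moment bounds to detection and recovery *)

Section conclusions.
Context {R : realType}.
Variables (d : nat) (X : prior R).
Hypothesis hX : unit_prior X.
Variable l : R.
Hypothesis l0 : 0 <= l.
Local Notation G n := (iid (normal_prob (0 : R) (Num.sqrt (2 / n%:R) : R))
                         #|{: {ffun 'I_d -> 'I_n}}|).

Let near_err (delta eps : R) : 0 < delta -> 0 < eps ->
  \forall n \near \oo, expR (- (n%:R * delta ^+ 2 / 4)) <= eps.
Proof.
move=> d0 e0.
have g0 : 0 < delta ^+ 2 / 4 by rewrite divr_gt0// exprn_gt0.
apply: filterS (near_expRN_le _ 1 eps g0 ler01 e0) => n.
by rewrite mul1r mulrA.
Qed.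

Lemma bounded_second_moment_contiguous (delta m : R) : 0 < delta ->
  (\forall n \near \oo, (second_moment (X n) (G n) (truncated d n l delta) <= m%:E)%E) ->
  contiguous (spiked_tensor d l X) (wigner_tensor R d).
Proof.
move=> d0 hm A mA QA; apply: cvge0_le => // eps e0.
pose M := `|m| + 1.
have M0 : 0 < M by rewrite ltr_wpDl.
have mM : m <= M by have := ler_norm m; rewrite /M; lra.
(* With theta fixed first, the moment term is eps/4; Q(A) is then taken small relative to theta, so
   that its term is eps/4 too. *)
pose theta := eps / (2 * M).
have th0 : 0 < theta by rewrite divr_gt0// mulr_gt0.
have q0 : 0 < theta * eps / 2 by rewrite divr_gt0// mulr_gt0.
have e4 : 0 < eps / 4 by rewrite divr_gt0.
near=> n.
have n0 : (0 < n)%N by near: n; exact: nbhs_infty_gt.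
have hQ : (wigner_tensor R d n (A n) <= (theta * eps / 2)%:E)%E.
  near: n; apply: filterS (cvge_near_dist _ 0 _ QA q0) => n /andP[_].
  by rewrite add0r.
have hn : (second_moment (X n) (G n) (truncated d n l delta) <= M%:E)%E.
  near: n; apply: filterS hm => n h.
  by rewrite (le_trans h)// lee_fin.
have he : expR (- (n%:R * delta ^+ 2 / 4)) <= eps / 4 by near: n; exact: near_err.
apply: (le_trans (spiked_le_sqr d n n0 l delta l0 (ltW d0) (X n) (hX n n0) (A n) theta (mA n) th0)).
have th20 : (0 <= (theta / 2)%:E)%E by rewrite lee_fin divr_ge0// ltW.
have th2i : (0 <= ((2 * theta)^-1)%:E)%E by rewrite lee_fin invr_ge0 mulr_ge0// ltW.
apply: (le_trans (leeD (leeD (lee_wpmul2l th20 hn) (lee_wpmul2l th2i hQ)) (lexx _))).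
rewrite -!EFinM -!EFinD lee_fin.
have -> : theta / 2 * M = eps / 4 by rewrite /theta; field; rewrite gt_eqF.
have -> : (2 * theta)^-1 * (theta * eps / 2) = eps / 4 by field; rewrite gt_eqF.
by lra.
Unshelve. all: by end_near. Qed.

Lemma vanishing_total_variation (delta : R) : 0 < delta ->
  (forall eps, 0 < eps -> \forall n \near \oo,
    (second_moment (X n) (G n) (truncated d n l delta) <= (1 + eps)%:E)%E) ->
  (total_variation_dist (spiked_tensor d l X n) (wigner_tensor R d n) @[n --> \oo] --> 0)%E.
Proof.
move=> d0 hm; apply: cvge0_le => [n|eps e0].
  apply: (le_trans (abse_ge0 (spiked_tensor d l X n set0 - wigner_tensor R d n set0)%E)).
  by apply: ereal_sup_ubound; exists set0 => //; exact: measurable0.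
have e4 : 0 < eps / 4 by rewrite divr_gt0.
(* Quadratic in eps because of the division by [2 * theta = eps]. *)
have ee : 0 < eps ^+ 2 / 32 by rewrite divr_gt0// exprn_gt0.
have th0 : 0 < eps / 2 by rewrite divr_gt0.
near=> n.
have n0 : (0 < n)%N by near: n; exact: nbhs_infty_gt.
have hn : (second_moment (X n) (G n) (truncated d n l delta) <= (1 + eps ^+ 2 / 32)%:E)%E.
  by near: n; exact: hm.
have he : expR (- (n%:R * delta ^+ 2 / 4)) <= eps / 4 by near: n; exact: near_err.
have he2 : expR (- (n%:R * delta ^+ 2 / 4)) <= eps ^+ 2 / 32 by near: n; exact: near_err.
have PQ (A : set (tensor R d n)) : measurable A ->
    fine (spiked_tensor d l X n A) <= fine (wigner_tensor R d n A) + eps.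
  move=> mA; rewrite -lee_fin EFinD !fineK ?fin_num_measure//.
  apply: (le_trans (spiked_le_wigner d n n0 l delta l0 (ltW d0) (X n) (hX n n0) A _ _ mA th0 hn)).
  apply: leeD2l; rewrite lee_fin; set err := expR _ in he he2 *.
  have : (1 + eps ^+ 2 / 32 - 1 + 2 * err) / (2 * (eps / 2)) <= eps / 4.
    by rewrite ler_pdivrMr ?mulr_gt0//; lra.
  by lra.
apply: ge_ereal_sup => _ [A mA <-].
(* The one-sided bound on the complement gives the other side. *)
have PA := PQ A mA; have PAc := PQ (~` A) (measurableC mA).
rewrite !probability_setC// in PAc.
rewrite -[spiked_tensor d l X n A]fineK ?fin_num_measure// in PAc *.
rewrite -[wigner_tensor R d n A]fineK ?fin_num_measure// in PAc *.
rewrite -EFinB /= lee_fin ler_norml.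
move: PAc; rewrite -!EFinB /= => PAc.
by apply/andP; split; lra.
Unshelve. all: by end_near. Qed.

Lemma vanishing_overlap_no_weak_recovery (delta : R) : 0 < delta ->
  (forall eps, 0 < eps -> \forall n \near \oo,
    (overlap_moment d n l delta (X n) <= eps%:E)%E) ->
  ~ weak_recovery d l X.
Proof.
move=> d0 hm [xhat [hx [c c0 hc]]].
(* With tau = c, each of the three inner terms is at most [c^2/8], so the correlation is at most
   [c/2 + 3c/16 < c]. *)
pose theta := c ^+ 2 / 4.
have th0 : 0 < theta by rewrite divr_gt0// exprn_gt0.
pose e1 := c ^+ 2 * theta / 4.
have e10 : 0 < e1 by rewrite divr_gt0// mulr_gt0// exprn_gt0.
have e20 : 0 < c ^+ 2 / 8 by rewrite divr_gt0// exprn_gt0.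
have [n [[hcn hmn] [hen n0]]] := filter_ex (filterI (filterI hc (hm _ e10))
  (filterI (near_err delta (c ^+ 2 / 8) d0 e20) (nbhs_infty_gt 0%N))).
have [mx ux] := hx n n0.
have := le_trans hcn (expected_correlation_le d n n0 l delta l0 (ltW d0) (X n) (hX n n0) _ _ _ mx ux c0 th0).
have th2i : (0 <= ((2 * theta)^-1)%:E)%E by rewrite lee_fin invr_ge0 mulr_ge0// ltW.
have c2i : (0 <= ((2 * c)^-1)%:E)%E by rewrite lee_fin invr_ge0 mulr_ge0// ltW.
move=> h; have := le_trans h (leeD (lexx _) (lee_wpmul2l c2i
  (leeD (leeD (lexx _) (lee_wpmul2l th2i hmn)) (lexx _)))).
rewrite -!(EFinM, EFinD) lee_fin.
set err := expR _ in hen *.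
have -> : (2 * theta)^-1 * e1 = c ^+ 2 / 8 by rewrite /e1; field; rewrite gt_eqF.
have : (2 * c)^-1 * (theta / 2 + c ^+ 2 / 8 + err) <= (2 * c)^-1 * (c ^+ 2 * 3 / 8).
  by rewrite ler_wpM2l ?invr_ge0 ?mulr_ge0 ?(ltW c0)// /theta; lra.
have -> : (2 * c)^-1 * (c ^+ 2 * 3 / 8) = c * 3 / 16 by field; rewrite gt_eqF.
by lra.
Qed.

End conclusions.

Theorem theorem2p6 (R : realType) (d : nat) (hd : (2 <= d)%N)
  (X : prior R) (hX : unit_prior X)
  (lambda_star : R) (hls : 0 < lambda_star)
  (hsym : symmetric_overlap X)
  (f : R -> R) (hf : rate_function X f)
  (hfd : forall t : R, 0 <= t < 1 ->
    lambda_star ^+ 2 / 2 * (t ^+ d / (1 + t ^+ d)) <= f t)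
  (sigma : R) (hs : 0 < sigma) (hsub : locally_subgaussian X (sigma ^+ 2))
  (hd2 : d = 2%N -> lambda_star <= sigma^-1) :
  forall lambda : R, 0 <= lambda -> lambda < lambda_star ->
    [/\ contiguous (spiked_tensor d lambda X) (wigner_tensor R d) /\
          ~ strong_detection (spiked_tensor d lambda X) (wigner_tensor R d),
        (3 <= d)%N ->
          (total_variation_dist (spiked_tensor d lambda X n)
             (wigner_tensor R d n) @[n --> \oo] --> 0%E) /\
          ~ weak_detection (spiked_tensor d lambda X) (wigner_tensor R d) &
        (3 <= d)%N -> ~ weak_recovery d lambda X].
Proof.
move=> l l0 lls.
have cubic := cubic_moments_vanish d X hsym lambda_star f hf hfd sigma hsub l l0 lls.
have contig : contiguous (spiked_tensor d l X) (wigner_tensor R d).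
  have [d3|] := leqP 3 d.
    have [delta d0 h] := cubic d3.
    apply: (bounded_second_moment_contiguous d X hX l l0 delta (1 + 1) d0).
    by apply: filterS (h 1 ltr01) => n [].
  rewrite ltnS => dle2; have d2 : d = 2%N by apply/eqP; rewrite eqn_leq dle2.
  have ls1 : l * sigma < 1.
    by rewrite -ltr_pdivlMr// div1r (lt_le_trans lls)// hd2.
  have [delta [m [d0 h]]] :=
    second_moment_bounded d X hsym lambda_star f hf hfd sigma hsub l l0 lls d2 ls1 hs.
  exact: (bounded_second_moment_contiguous d X hX l l0 delta m d0).
split.
- by split=> //; exact: contiguous_no_strong_detection.
- move=> d3; have [delta d0 h] := cubic d3.
  have tv : (total_variation_dist (spiked_tensor d l X n) (wigner_tensor R d n)
      @[n --> \oo] --> 0)%E.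
    apply: (vanishing_total_variation d X hX l l0 delta d0) => eps e0.
    by apply: filterS (h eps e0) => n [].
  by split=> //; exact: total_variation_no_weak_detection.
- move=> d3; have [delta d0 h] := cubic d3.
  apply: (vanishing_overlap_no_weak_recovery d X hX l l0 delta d0) => eps e0.
  by apply: filterS (h eps e0) => n [].
Qed.
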